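(* Let $\mathcal{C}$ be a Frobenius extriangulated category with stable category $\underline{\mathcal{C}}$. The assignments $$\Psi:\underline{\mathcal{M}}\mapsto \mathcal{M}^{\perp}\qquad\text{and}\qquad \Phi:\mathcal{H}\mapsto \underline{\mathcal{H}\cap{}^{\perp}\mathcal{H}}$$ give mutually inverse bijections between the following classes: (1) Silting subcategories $\underline{\mathcal{M}}$ of the stable category $\underline{\mathcal{C}}$ with $Proj(\mathcal{C})\subseteq\mathcal{M}$. (2) Subcategories $\mathcal{H}$ of $\mathcal{C}$ which are specially covariantly finite and coresolving in $\mathcal{C}$, such that $\check{\mathcal{H}}=\mathcal{C}$ and such that for any $H\in\mathcal{H}$ there exists a positive integer $t\geq 1$ with $\mathbb{E}^{i}(H,\mathcal{H})=0$ (i.e. $\mathbb{E}^{i}(H,H')=0$ for all $H'\in\mathcal{H}$) for all $i\geq t$.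
   Context: Extriangulated categories (Nakaoka--Palu). An extriangulated category is a triple $(\mathcal{C},\mathbb{E},\mathfrak{s})$, abbreviated $\mathcal{C}$, where $\mathcal{C}$ is an additive category, $\mathbb{E}:\mathcal{C}^{\rm op}\times\mathcal{C}\to\mathrm{Ab}$ is an additive bifunctor (for $\delta\in\mathbb{E}(C,A)$, $a:A\to A'$, $c:C'\to C$ put $a_*\delta=\mathbb{E}(C,a)(\delta)$, $c^*\delta=\mathbb{E}(c,A)(\delta)$), and $\mathfrak{s}$ assigns to each $\delta\in\mathbb{E}(C,A)$ an equivalence class $\mathfrak{s}(\delta)=[A\xrightarrow{x}B\xrightarrow{y}C]$ (equivalence: isomorphism of middle terms compatible with $\mathrm{Id}_A,\mathrm{Id}_C$) such that, for $\mathfrak{s}(\delta)=[A\xrightarrow{x}B\xrightarrow{y}C]$ and $\mathfrak{s}(\delta')=[A'\xrightarrow{x'}B'\xrightarrow{y'}C']$: (realization) if $a:A\to A'$, $c:C\to C'$ satisfy $a_*\delta=c^*\delta'$, there is $b:B\to B'$ with $bx=x'a$, $y'b=cy$; (additivity) $\mathfrak{s}(0)=[A\to A\oplus C\to C]$ and $\mathfrak{s}(\delta\oplus\delta')=\mathfrak{s}(\delta)\oplus\mathfrak{s}(\delta')$; (ET3) if $bx=x'a$, there is $c$ with $cy=y'b$ and $a_*\delta=c^*\delta'$; (ET4) if $\delta\in\mathbb{E}(D,A)$, $\delta'\in\mathbb{E}(F,B)$ are realized by $A\xrightarrow{f}B\xrightarrow{f'}D$ and $B\xrightarrow{g}C\xrightarrow{g'}F$,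 there are an object $E$, morphisms $h=gf$, $h':C\to E$, $d:D\to E$, $e:E\to F$ with $h'g=df'$, $eh'=g'$, and $\delta''\in\mathbb{E}(E,A)$ realized by $A\xrightarrow{h}C\xrightarrow{h'}E$, such that $D\xrightarrow{d}E\xrightarrow{e}F$ realizes $f'_*\delta'$, $d^*\delta''=\delta$, $f_*\delta''=e^*\delta'$; and the duals of (ET3), (ET4). An $\mathbb{E}$-triangle (conflation) $A\xrightarrow{x}B\xrightarrow{y}C$ is a sequence realizing some $\delta\in\mathbb{E}(C,A)$; $x$ is an inflation with cone $C$, $y$ is a deflation with cocone $A$. $P$ is projective if $\mathbb{E}(P,-)=0$; $\mathcal{C}$ has enough projectives if every object $C$ admits a deflation $P\to C$ with $P$ projective; injectives and enough injectives are dual. $Proj(\mathcal{C})$, $Inj(\mathcal{C})$ are the subcategories of projectives and injectives. ''Subcategory'' always means full additive subcategory closed under isomorphisms and direct summands. $\mathcal{C}$ is Frobenius if it has enough projectives and enough injectives and the projectives coincide with the injectives. Its stable category $\underline{\mathcal{C}}$ has the objects of $\mathcal{C}$ and morphisms those of $\mathcal{C}$ modulo the morphisms factoring through projectives. It is triangulated: for each $A$ choose an $\mathbb{E}$-triangle $A\to I\to A[1]$ with $I$ injective, realizing $\delta_A$; this defines the shift $[1]$; an $\mathbb{E}$-triangle $A\xrightarrow{x}B\xrightarrow{y}C$ realizing $\theta$ gives a standard triangle $A\xrightarrow{\underline{x}}B\xrightarrow{\underline{y}}C\xrightarrow{\underline{z}}A[1]$, where $z$ completes a morphism $(\mathrm{Id}_A,b,z)$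 of $\mathbb{E}$-triangles to $A\to I\to A[1]$ (so $z^*\delta_A=\theta$); distinguished triangles are those isomorphic to standard ones. For a subcategory $\mathcal{M}\supseteq Proj(\mathcal{C})$ of $\mathcal{C}$, $\underline{\mathcal{M}}$ is the full subcategory of $\underline{\mathcal{C}}$ on the objects of $\mathcal{M}$. Higher extensions: for $\mathbb{E}$-triangles $\Omega X\to P\to X$ and $Y\to I\to\Sigma Y$ with $P$ projective and $I$ injective, $\mathbb{E}^{1}=\mathbb{E}$ and $\mathbb{E}^{i+1}(X,Y)\cong\mathbb{E}(X,\Sigma^{i}Y)\cong\mathbb{E}(\Omega^{i}X,Y)$. For a subcategory $\mathcal{X}$ of $\mathcal{C}$: $\mathcal{X}^{\perp}=\{Y\in\mathcal{C}\mid\mathbb{E}^{i}(X,Y)=0\ \forall i\ge1,\forall X\in\mathcal{X}\}$ and ${}^{\perp}\mathcal{X}=\{Y\in\mathcal{C}\mid\mathbb{E}^{i}(Y,X)=0\ \forall i\ge1,\forall X\in\mathcal{X}\}$. $\mathcal{H}$ is coresolving if it contains $Inj(\mathcal{C})$ and is closed under extensions (the middle term of an $\mathbb{E}$-triangle with end terms in $\mathcal{H}$ is in $\mathcal{H}$) and cones of inflations (in an $\mathbb{E}$-triangle $A\to B\to C$ with $A,B\in\mathcal{H}$ also $C\in\mathcal{H}$). $\mathcal{H}$ is specially covariantly finite in $\mathcal{C}$ if for every $C\in\mathcal{C}$ there is an $\mathbb{E}$-triangle $C\to H\to K$ with $H\in\mathcal{H}$ and $\mathbb{E}(K,\mathcal{H})=0$.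 $\check{\mathcal{H}}$ is the class of objects $C$ such that for some $n\ge0$ there is an $\mathbb{E}$-triangle sequence $C\to H_{0}\to H_{-1}\to\cdots\to H_{-n}$ with all $H_{-i}\in\mathcal{H}$, i.e. there are $\mathbb{E}$-triangles $K_i\to H_{-i}\to K_{i+1}$ ($0\le i\le n-1$) with $K_0=C$, $K_n=H_{-n}$ (for $n=0$: $C\cong H_0$). A subcategory $\mathcal{S}$ of a triangulated category $\mathcal{T}$ is silting if $\mathrm{Hom}_{\mathcal{T}}(\mathcal{S},\mathcal{S}[i])=0$ for all $i>0$ and $\mathcal{T}$ is the smallest triangulated subcategory of $\mathcal{T}$ containing $\mathcal{S}$ and closed under direct summands and isomorphisms. *)

(* Defs.v *)
From HB Require Import structures.
From mathcomp Require Import all_boot all_algebra.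
From mathcomp Require Import boolp classical_sets.

Set Implicit Arguments.
Unset Strict Implicit.
Unset Printing Implicit Defensive.

Import GRing.Theory.

Local Open Scope ring_scope.
Local Open Scope classical_set_scope.

Declare Scope cat_scope.
Delimit Scope cat_scope with cat.
Local Open Scope cat_scope.

Record preadditive_category := PreadditiveCategory {
  obj :> Type;
  hom : obj -> obj -> zmodType;
  idc : forall A, hom A A;
  hcomp : forall A B C, hom B C -> hom A B -> hom A C;
  compA : forall A B C D (h : hom C D) (g : hom B C) (f : hom A B),
    hcomp h (hcomp g f) = hcomp (hcomp h g) f;
  comp1c : forall A B (f : hom A B), hcomp (idc B) f = f;
  compc1 : forall A B (f : hom A B), hcomp f (idc A) = f;
  compDl : forall A B C (g g' : hom B C) (f : hom A B),
    hcomp (g + g') f = hcomp g f + hcomp g' f;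
  compDr : forall A B C (g : hom B C) (f f' : hom A B),
    hcomp g (f + f') = hcomp g f + hcomp g f' }.

Arguments hom {p} A B.
Arguments idc {p} A.
Arguments hcomp {p A B C} g f.

Notation "g \oc f" := (hcomp g f) (at level 40, left associativity) : cat_scope.

Definition is_zero (C : preadditive_category) (Z : C) : Prop :=
  forall A : C, (forall f : hom A Z, f = 0) /\ (forall f : hom Z A, f = 0).

Record biproduct (C : preadditive_category) (A B : C) := Biproduct {
  bip_obj :> C;
  injl : hom A bip_obj;
  injr : hom B bip_obj;
  prl : hom bip_obj A;
  prr : hom bip_obj B;
  prl_inl : prl \oc injl = idc A;
  prr_inr : prr \oc injr = idc B;
  prl_inr : prl \oc injr = 0;
  prr_inl : prr \oc injl = 0;
  bip_id : injl \oc prl + injr \oc prr = idc bip_obj }.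

Arguments injl {C A B} b.
Arguments injr {C A B} b.
Arguments prl {C A B} b.
Arguments prr {C A B} b.

Record additive_category := AdditiveCategory {
  additive_base :> preadditive_category;
  zero_exists : exists Z : additive_base, is_zero Z;
  biproduct_exists : forall A B : additive_base, inhabited (biproduct A B) }.

Definition is_iso (C : preadditive_category) (A B : C) (f : hom A B) : Prop :=
  exists g : hom B A, g \oc f = idc A /\ f \oc g = idc B.

Definition isomorphic (C : preadditive_category) (A B : C) : Prop :=
  exists f : hom A B, is_iso f.

(* f (+) f' *)
Definition bimap (C : preadditive_category) (A A' B B' : C)
    (SA : biproduct A A') (SB : biproduct B B') (f : hom A B) (f' : hom A' B') :
    hom SA SB :=
  injl SB \oc f \oc prl SA + injr SB \oc f' \oc prr SA.

(* Full additive subcategories closed under isomorphisms and direct summands,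
   given by their classes of objects. *)
Record is_subcategory (C : additive_category) (X : set C) : Prop := IsSubcategory {
  subcat_zero : forall Z : C, is_zero Z -> X Z;
  subcat_iso : forall A B : C, isomorphic A B -> X A -> X B;
  subcat_sum : forall (A B : C) (S : biproduct A B), X A -> X B -> X S;
  subcat_summand : forall (A B : C) (S : biproduct A B), X S -> X A /\ X B }.

(* Additive bifunctors C^op x C -> Ab; [push a d] is a_* d, [pull c d] is c^* d. *)
Record bifunctor (C : additive_category) := Bifunctor {
  bif_obj :> C -> C -> zmodType;
  push : forall (X A A' : C), hom A A' -> bif_obj X A -> bif_obj X A';
  pull : forall (X X' A : C), hom X' X -> bif_obj X A -> bif_obj X' A;
  push1 : forall (X A : C) (d : bif_obj X A), push (idc A) d = d;
  pull1 : forall (X A : C) (d : bif_obj X A), pull (idc X) d = d;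
  push_comp : forall (X A A' A'' : C) (a' : hom A' A'') (a : hom A A')
    (d : bif_obj X A), push (a' \oc a) d = push a' (push a d);
  pull_comp : forall (X X' X'' A : C) (c : hom X' X) (c' : hom X'' X')
    (d : bif_obj X A), pull (c \oc c') d = pull c' (pull c d);
  push_pull : forall (X X' A A' : C) (a : hom A A') (c : hom X' X)
    (d : bif_obj X A), push a (pull c d) = pull c (push a d);
  pushDr : forall (X A A' : C) (a : hom A A') (d d' : bif_obj X A),
    push a (d + d') = push a d + push a d';
  pullDr : forall (X X' A : C) (c : hom X' X) (d d' : bif_obj X A),
    pull c (d + d') = pull c d + pull c d';
  pushDl : forall (X A A' : C) (a a' : hom A A') (d : bif_obj X A),
    push (a + a') d = push a d + push a' d;
  pullDl : forall (X X' A : C) (c c' : hom X' X) (d : bif_obj X A),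
    pull (c + c') d = pull c d + pull c' d }.

Arguments push {C b X A A'} a d.
Arguments pull {C b X X' A} c d.

(* The element d (+) d' of E(X (+) X', A (+) A'), i.e. (d, 0, 0, d') under
   E(X (+) X', A (+) A') = E(X, A) x E(X, A') x E(X', A) x E(X', A'). *)
Definition ext_sum (C : additive_category) (E : bifunctor C) (X X' A A' : C)
    (SX : biproduct X X') (SA : biproduct A A') (d : E X A) (d' : E X' A') :
    E SX SA :=
  push (injl SA) (pull (prl SX) d) + push (injr SA) (pull (prr SX) d').

(* Sequences A -> B -> X with fixed ends A and X. *)
Record sequence (C : additive_category) (A X : C) := Sequence {
  seq_mid : C;
  seq_in : hom A seq_mid;
  seq_out : hom seq_mid X }.

Definition seq_equiv (C : additive_category) (A X : C) (u v : sequence A X) : Prop :=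
  exists b : hom (seq_mid u) (seq_mid v),
    [/\ is_iso b, b \oc seq_in u = seq_in v & seq_out v \oc b = seq_out u].

Record extriangulated_category := ExtriangulatedCategory {
  extri_base :> additive_category;
  ext1 : bifunctor extri_base;
  (* s(d), as the set of the sequences that belong to the class *)
  rlz : forall (A X : extri_base), ext1 X A -> set (sequence A X);
  rlz_class : forall (A X : extri_base) (d : ext1 X A),
    exists u : sequence A X, rlz d = [set v | seq_equiv u v];
  rlz_map : forall (A B X A' B' X' : extri_base)
    (x : hom A B) (y : hom B X) (d : ext1 X A)
    (x' : hom A' B') (y' : hom B' X') (d' : ext1 X' A')
    (a : hom A A') (c : hom X X'),
    rlz d (Sequence x y) -> rlz d' (Sequence x' y') ->
    push a d = pull c d' ->
    exists b : hom B B', b \oc x = x' \oc a /\ y' \oc b = c \oc y;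
  rlz0 : forall (A X : extri_base) (S : biproduct A X),
    rlz (0 : ext1 X A) (Sequence (injl S) (prr S));
  rlz_sum : forall (A B X A' B' X' : extri_base)
    (x : hom A B) (y : hom B X) (d : ext1 X A)
    (x' : hom A' B') (y' : hom B' X') (d' : ext1 X' A')
    (SA : biproduct A A') (SB : biproduct B B') (SX : biproduct X X'),
    rlz d (Sequence x y) -> rlz d' (Sequence x' y') ->
    rlz (ext_sum SX SA d d') (Sequence (bimap SA SB x x') (bimap SB SX y y'));
  ET3 : forall (A B X A' B' X' : extri_base)
    (x : hom A B) (y : hom B X) (d : ext1 X A)
    (x' : hom A' B') (y' : hom B' X') (d' : ext1 X' A')
    (a : hom A A') (b : hom B B'),
    rlz d (Sequence x y) -> rlz d' (Sequence x' y') ->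
    b \oc x = x' \oc a ->
    exists c : hom X X', c \oc y = y' \oc b /\ push a d = pull c d';
  ET3op : forall (A B X A' B' X' : extri_base)
    (x : hom A B) (y : hom B X) (d : ext1 X A)
    (x' : hom A' B') (y' : hom B' X') (d' : ext1 X' A')
    (b : hom B B') (c : hom X X'),
    rlz d (Sequence x y) -> rlz d' (Sequence x' y') ->
    c \oc y = y' \oc b ->
    exists a : hom A A', b \oc x = x' \oc a /\ push a d = pull c d';
  ET4 : forall (A B D X F : extri_base)
    (f : hom A B) (f' : hom B D) (d1 : ext1 D A)
    (g : hom B X) (g' : hom X F) (d2 : ext1 F B),
    rlz d1 (Sequence f f') -> rlz d2 (Sequence g g') ->
    exists (E : extri_base) (h' : hom X E) (d : hom D E) (e : hom E F)
           (d3 : ext1 E A),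
      [/\ h' \oc g = d \oc f', e \oc h' = g' & rlz d3 (Sequence (g \oc f) h')] /\
      [/\ rlz (push f' d2) (Sequence d e), pull d d3 = d1 &
          push f d3 = pull e d2];
  ET4op : forall (A B D X F : extri_base)
    (f : hom B A) (f' : hom D B) (d1 : ext1 A D)
    (g : hom X B) (g' : hom F X) (d2 : ext1 B F),
    rlz d1 (Sequence f' f) -> rlz d2 (Sequence g' g) ->
    exists (E : extri_base) (h' : hom E X) (d : hom E D) (e : hom F E)
           (d3 : ext1 A E),
      [/\ g \oc h' = f' \oc d, h' \oc e = g' & rlz d3 (Sequence h' (f \oc g))] /\
      [/\ rlz (pull f' d2) (Sequence e d), push d d3 = d1 &
          pull f d3 = push e d2] }.

Arguments ext1 {e}.
Arguments rlz {e A X} d.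

Section Extriangulated.
Variable C : extriangulated_category.
Implicit Types (A B K X Y P : C) (H M : set C).

Definition realizes A B X (x : hom A B) (y : hom B X) (d : ext1 X A) : Prop :=
  rlz d (Sequence x y).

Definition conflation A B X (x : hom A B) (y : hom B X) : Prop :=
  exists d : ext1 X A, realizes x y d.

Definition projective P : Prop := forall A (d : ext1 P A), d = 0.
Definition injective_obj I : Prop := forall X (d : ext1 X I), d = 0.

Definition Proj : set C := [set P | projective P].
Definition Inj : set C := [set I | injective_obj I].

Definition enough_projectives : Prop :=
  forall X, exists A P (x : hom A P) (y : hom P X), projective P /\ conflation x y.
Definition enough_injectives : Prop :=
  forall A, exists I X (x : hom A I) (y : hom I X), injective_obj I /\ conflation x y.

Definition frobenius : Prop :=
  [/\ enough_projectives, enough_injectives & Proj = Inj].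

Definition coresolving H : Prop :=
  [/\ Inj `<=` H,
      forall A B X (x : hom A B) (y : hom B X), conflation x y ->
        H A -> H X -> H B
    & forall A B X (x : hom A B) (y : hom B X), conflation x y ->
        H A -> H B -> H X].

Definition specially_covariantly_finite H : Prop :=
  forall X, exists B K (x : hom X B) (y : hom B K),
    [/\ conflation x y, H B & forall Y, H Y -> forall d : ext1 K Y, d = 0].

(* [B i] is the object H_{-i}. *)
Definition check_class H : set C :=
  [set X | exists (n : nat) (B K : nat -> C),
    [/\ K 0%N = X, isomorphic (K n) (B n),
        forall i, (i <= n)%N -> H (B i)
      & forall i, (i < n)%N ->
          exists (x : hom (K i) (B i)) (y : hom (B i) (K i.+1)), conflation x y]].

End Extriangulated.

Arguments projective {C} P.
Arguments injective_obj {C} I.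
Arguments Proj : clear implicits.
Arguments Inj : clear implicits.

(* A choice, for every object A, of A -> I -> Sigma A with I injective and of an
   element delta_A that it realizes. *)
Record cosyzygy_choice (C : extriangulated_category) := CosyzygyChoice {
  Sigma : C -> C;
  hull : C -> C;
  hull_in : forall A, hom A (hull A);
  hull_out : forall A, hom (hull A) (Sigma A);
  delta : forall A, ext1 (Sigma A) A;
  hull_injective : forall A, injective_obj (hull A);
  delta_realized : forall A, realizes (hull_in A) (hull_out A) (delta A) }.

Section HigherExtensions.
Variables (C : extriangulated_category) (J : cosyzygy_choice C).

(* E^i(X, Y) = E(X, Sigma^(i-1) Y); only meant for i >= 1. *)
Definition ext (i : nat) (X Y : C) : zmodType := ext1 X (iter i.-1 (Sigma J) Y).

Definition right_perp (X : set C) : set C :=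
  [set Y | forall i, (1 <= i)%N -> forall A, X A -> forall d : ext i A Y, d = 0].

Definition left_perp (X : set C) : set C :=
  [set Y | forall i, (1 <= i)%N -> forall A, X A -> forall d : ext i Y A, d = 0].

End HigherExtensions.

Section Basics.
Variable C : preadditive_category.

Lemma comp0c (A B X : C) (f : hom A B) : (0 : hom B X) \oc f = 0.
Proof. by apply: (addrI (0 \oc f)); rewrite -compDl !addr0. Qed.

Lemma compc0 (A B X : C) (g : hom B X) : g \oc (0 : hom A B) = 0.
Proof. by apply: (addrI (g \oc 0)); rewrite -compDr !addr0. Qed.

Lemma compNc (A B X : C) (g : hom B X) (f : hom A B) : (- g) \oc f = - (g \oc f).
Proof. by apply: (addrI (g \oc f)); rewrite -compDl !subrr comp0c. Qed.

Lemma compcN (A B X : C) (g : hom B X) (f : hom A B) : g \oc (- f) = - (g \oc f).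
Proof. by apply: (addrI (g \oc f)); rewrite -compDr !subrr compc0. Qed.

Lemma compBl (A B X : C) (g g' : hom B X) (f : hom A B) :
  (g - g') \oc f = g \oc f - g' \oc f.
Proof. by rewrite compDl compNc. Qed.

Lemma compBr (A B X : C) (g : hom B X) (f f' : hom A B) :
  g \oc (f - f') = g \oc f - g \oc f'.
Proof. by rewrite compDr compcN. Qed.

End Basics.

Section StableHom.
Variable C : extriangulated_category.

Lemma push0 (X A A' : C) (a : hom A A') : push a (0 : ext1 X A) = 0.
Proof. by apply: (addrI (push a 0)); rewrite -pushDr !addr0. Qed.

Lemma pull0 (X X' A : C) (c : hom X' X) : pull c (0 : ext1 X A) = 0.
Proof. by apply: (addrI (pull c 0)); rewrite -pullDr !addr0. Qed.

Lemma pull0c (X X' A : C) (d : ext1 X A) : pull (0 : hom X' X) d = 0.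
Proof. by apply: (addrI (pull 0 d)); rewrite -pullDl !addr0. Qed.

Lemma pushNc (X A A' : C) (a : hom A A') (d : ext1 X A) : push (- a) d = - push a d.
Proof.
apply: (addrI (push a d)); rewrite -pushDl !subrr.
by apply: (addrI (push 0 d)); rewrite -pushDl !addr0.
Qed.

Lemma pullNc (X X' A : C) (c : hom X' X) (d : ext1 X A) : pull (- c) d = - pull c d.
Proof. by apply: (addrI (pull c d)); rewrite -pullDl !subrr pull0c. Qed.

Lemma projective_sum (P Q : C) (S : biproduct P Q) :
  projective P -> projective Q -> projective S.
Proof.
move=> hP hQ A d; rewrite -[d]pull1 -(bip_id S) pullDl !pull_comp.
by rewrite (hP _ (pull (injl S) d)) (hQ _ (pull (injr S) d)) !pull0 addr0.
Qed.

Lemma projective_zero (Z : C) : is_zero Z -> projective Z.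
Proof. by move=> hZ A d; rewrite -[d]pull1 ((hZ Z).1 (idc Z)) pull0c. Qed.

Definition via_proj (A B : C) : pred (hom A B) := fun f =>
  `[< exists (P : C) (g : hom P B) (h : hom A P), projective P /\ f = g \oc h >].

Lemma via_proj_zmod_closed (A B : C) : zmod_closed (@via_proj A B).
Proof.
split=> [|f f' /asboolP[P [g [h [hP ->]]]] /asboolP[P' [g' [h' [hP' ->]]]]];
  apply/asboolP.
  have [Z hZ] := zero_exists C; exists Z, 0, 0.
  by rewrite comp0c; split => //; exact: projective_zero.
have [S] := biproduct_exists P P'.
exists S, (g \oc prl S - g' \oc prr S), (injl S \oc h + injr S \oc h').
split; first exact: projective_sum.
rewrite compBl !compDr -!compA.
rewrite !(compA (prl S)) !(compA (prr S)) prl_inl prr_inr prl_inr prr_inl.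
by rewrite !comp1c !comp0c !compc0 addr0 add0r.
Qed.

Definition proj_ideal (A B : C) : zmodClosed (hom A B) :=
  HB.pack (@via_proj A B)
    (GRing.isZmodClosed.Build (hom A B) (@via_proj A B) (@via_proj_zmod_closed A B)).

Lemma via_proj_compl (A B X : C) (g : hom B X) (f : hom A B) :
  via_proj f -> via_proj (g \oc f).
Proof.
move=> /asboolP[P [u [v [hP ->]]]]; apply/asboolP.
by exists P, (g \oc u), v; rewrite compA.
Qed.

Lemma via_proj_compr (A B X : C) (g : hom B X) (f : hom A B) :
  via_proj g -> via_proj (g \oc f).
Proof.
move=> /asboolP[P [u [v [hP ->]]]]; apply/asboolP.
by exists P, u, (v \oc f); rewrite compA.
Qed.

Definition stable_hom (A B : C) : zmodType := Quotient.quot (proj_ideal A B).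

Local Open Scope quotient_scope.

Definition cls (A B : C) (f : hom A B) : stable_hom A B := \pi f.

Lemma clsE (A B : C) (f f' : hom A B) : cls f = cls f' <-> via_proj (f - f').
Proof.
have := @Quotient.idealrBE _ (proj_ideal A B) f f'.
rewrite /cls => h; split=> [/eqP|hf]; first by rewrite -h.
by apply/eqP; rewrite -h.
Qed.

Lemma cls_repr (A B : C) (f : stable_hom A B) : cls (repr f) = f.
Proof. exact: reprK. Qed.

Lemma clsD (A B : C) (f f' : hom A B) : cls (f + f') = cls f + cls f'.
Proof. by rewrite /cls !piE. Qed.

Lemma cls0 (A B : C) : cls (0 : hom A B) = 0.
Proof. by rewrite /cls !piE. Qed.

Definition stable_comp (A B X : C) (g : stable_hom B X) (f : stable_hom A B) :
  stable_hom A X := cls (repr g \oc repr f).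

Lemma stable_compE (A B X : C) (g : hom B X) (f : hom A B) :
  stable_comp (cls g) (cls f) = cls (g \oc f).
Proof.
apply/clsE.
set g' := repr _; set f' := repr _.
have hg : via_proj (g' - g) by apply/clsE; rewrite cls_repr.
have hf : via_proj (f' - f) by apply/clsE; rewrite cls_repr.
have -> : g' \oc f' - g \oc f = g' \oc (f' - f) + (g' - g) \oc f.
  by rewrite compBr compBl addrA subrK.
have h1 := via_proj_compl g' hf.
have h2 := via_proj_compr f hg.
exact: (@rpredD _ (proj_ideal A X) _ _ h1 h2).
Qed.

End StableHom.

Section StableCategory.
Variable C : extriangulated_category.

Definition stable_preadditive : preadditive_category.
Proof.
refine (@PreadditiveCategory C (@stable_hom C) (fun A => cls (idc A))
  (@stable_comp C) _ _ _ _ _).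
- move=> A B X Y h g f.
  by rewrite -(cls_repr h) -(cls_repr g) -(cls_repr f) !stable_compE compA.
- by move=> A B f; rewrite -(cls_repr f) stable_compE comp1c.
- by move=> A B f; rewrite -(cls_repr f) stable_compE compc1.
- move=> A B X g g' f; rewrite -(cls_repr g) -(cls_repr g') -(cls_repr f).
  by rewrite -clsD !stable_compE compDl clsD.
- move=> A B X g f f'; rewrite -(cls_repr g) -(cls_repr f) -(cls_repr f').
  by rewrite -clsD !stable_compE compDr clsD.
Defined.

Lemma stable_zero_exists : exists Z : stable_preadditive, is_zero Z.
Proof.
have [Z hZ] := zero_exists C; exists Z => A; split => f.
  by rewrite -[f]cls_repr ((hZ A).1 (repr f)) cls0.
by rewrite -[f]cls_repr ((hZ A).2 (repr f)) cls0.
Qed.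

Lemma stable_biproduct_exists (A B : stable_preadditive) :
  inhabited (biproduct A B).
Proof.
have [S] := @biproduct_exists C (A : C) (B : C).
split; refine (@Biproduct stable_preadditive A B (bip_obj S)
  (cls (injl S)) (cls (injr S)) (cls (prl S)) (cls (prr S)) _ _ _ _ _).
- by rewrite /= stable_compE prl_inl.
- by rewrite /= stable_compE prr_inr.
- by rewrite /= stable_compE prl_inr cls0.
- by rewrite /= stable_compE prr_inl cls0.
- by rewrite /= !stable_compE -clsD bip_id.
Qed.

Definition stable : additive_category :=
  AdditiveCategory stable_zero_exists stable_biproduct_exists.

(* The full subcategory of [stable] on the objects of M. *)
Definition stable_sub (M : set C) : set stable := M.

End StableCategory.

(* An additive category with a shift and a class of triangles
   A -> B -> X -> A[1]. Being silting depends only on these data, and not on the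
   axioms of triangulated categories. *)
Record triangle_data (T : additive_category) := TriangleData {
  shift : T -> T;
  shift_hom : forall A B, hom A B -> hom (shift A) (shift B);
  distinguished : forall A B X, hom A B -> hom B X -> hom X (shift A) -> Prop }.

Section Silting.
Variables (T : additive_category) (D : triangle_data T).

(* Triangulated subcategories closed under direct summands and isomorphisms.
   As U is closed under isomorphisms, [thick_shift] is closure under [1] and [-1]. *)
Record thick (U : set T) : Prop := Thick {
  thick_subcategory : is_subcategory U;
  thick_shift : forall A, U A <-> U (shift D A);
  thick_triangle : forall A B X (u : hom A B) (v : hom B X)
      (w : hom X (shift D A)), distinguished u v w ->
    [/\ U A -> U B -> U X, U B -> U X -> U A & U A -> U X -> U B] }.

Record silting (S : set T) : Prop := Silting {
  silting_subcategory : is_subcategory S;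
  silting_rigid : forall A B, S A -> S B -> forall i, (0 < i)%N ->
    forall f : hom A (iter i (shift D) B), f = 0;
  silting_generates : forall U, thick U -> S `<=` U -> setT `<=` U }.

End Silting.

Section StableTriangles.
Variables (C : extriangulated_category) (J : cosyzygy_choice C).

(* phi[1] is the class of the morphisms g such that (f, b, g) is, for some f in phi
   and some b, a morphism from A -> I -> A[1] to B -> I' -> B[1]. *)
Definition stable_shift_hom (A B : stable C) (phi : hom A B) :
    @hom (stable C) (Sigma J A) (Sigma J B) :=
  xget 0 [set psi | exists (f : @hom C A B) (g : @hom C (Sigma J A) (Sigma J B)),
    [/\ phi = cls f, psi = cls g & push f (delta J A) = pull g (delta J B)]].

Definition standard_triangle (A B X : stable C)
    (u : hom A B) (v : hom B X) (w : @hom (stable C) X (Sigma J A)) : Prop :=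
  exists (x : @hom C A B) (y : @hom C B X) (z : @hom C X (Sigma J A))
         (theta : ext1 (X : C) (A : C)),
    [/\ realizes x y theta, pull z (delta J A) = theta
      & [/\ u = cls x, v = cls y & w = cls z]].

Definition stable_distinguished (A B X : stable C)
    (u : hom A B) (v : hom B X) (w : @hom (stable C) X (Sigma J A)) : Prop :=
  exists (A' B' X' : stable C) (u' : hom A' B') (v' : hom B' X')
         (w' : @hom (stable C) X' (Sigma J A'))
         (a : hom A' A) (b : hom B' B) (c : hom X' X),
    [/\ standard_triangle u' v' w', [/\ is_iso a, is_iso b & is_iso c],
        b \oc u' = u \oc a, c \oc v' = v \oc b
      & stable_shift_hom a \oc w' = w \oc c].

Definition stable_triangles : triangle_data (stable C) :=
  @TriangleData (stable C) (Sigma J : stable C -> stable C)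
    stable_shift_hom stable_distinguished.

(* In the Frobenius case [stable_shift_hom] never takes the default value of
   [xget], and does not depend on the choices. *)
Lemma cosyzygy_lift (X A : C) (d : ext1 X A) :
  exists g : hom X (Sigma J A), d = pull g (delta J A).
Proof.
have [[B x y] hd] := rlz_class d.
have {}hd : rlz d (Sequence x y).
  by rewrite hd; exists (idc B); rewrite /= comp1c compc1; split => //;
     exists (idc B); rewrite comp1c.
have [Z hZ] := zero_exists C.
have [S] := biproduct_exists (hull J A) Z.
have e : push (hull_in J A) d = pull (0 : hom X Z) (0 : ext1 Z (hull J A)).
  by rewrite pull0; exact: hull_injective.
have [b [hb _]] := rlz_map hd (rlz0 S) e.
have hb' : (prl S \oc b) \oc x = hull_in J A \oc idc A.
  by rewrite -compA hb compA prl_inl comp1c compc1.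
have [g [_]] := ET3 hd (delta_realized J A) hb'.
by rewrite push1 => ->; exists g.
Qed.

Lemma pull_delta_eq0 (X A : C) (g : hom X (Sigma J A)) :
  Proj C = Inj C -> pull g (delta J A) = 0 -> via_proj g.
Proof.
move=> PI h; have [S] := biproduct_exists A X.
have e : push (idc A) (0 : ext1 X A) = pull g (delta J A) by rewrite push0 h.
have [b [_ hb]] := rlz_map (rlz0 S) (delta_realized J A) e.
apply/asboolP; exists (hull J A), (hull_out J A), (b \oc injr S); split.
  have : Inj C (hull J A) by exact: hull_injective.
  by rewrite -PI.
by rewrite compA hb -compA prr_inr compc1.
Qed.

Lemma stable_shift_homE (A B : C) (f : hom A B) (g : hom (Sigma J A) (Sigma J B)) :
  Proj C = Inj C -> push f (delta J A) = pull g (delta J B) ->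
  @stable_shift_hom A B (cls f) = cls g.
Proof.
move=> PI h; rewrite /stable_shift_hom; case: xgetP => [psi _|/(_ (cls g)) []].
  move=> [f' [g' [/clsE /asboolP[P [u [v [hP e]]]] -> h']]].
  apply/clsE/(pull_delta_eq0 PI).
  rewrite pullDl pullNc -h -h' -pushNc -pushDl -opprB e pushNc push_comp.
  have hI : Inj C P by rewrite -PI.
  by rewrite (hI _ (push v _)) push0 oppr0.
by exists f, g.
Qed.

End StableTriangles.

Section Bijection.
Variables (C : extriangulated_category) (J : cosyzygy_choice C).

Definition silting_class : set (set (stable C)) :=
  [set S | exists M : set C, [/\ is_subcategory M, Proj C `<=` M,
     S = stable_sub M & silting (stable_triangles J) S]].

Definition coresolving_class : set (set C) :=
  [set H | [/\ is_subcategory H, specially_covariantly_finite H, coresolving H,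
     check_class H = setT
   & forall X, H X -> exists2 t : nat, (1 <= t)%N &
       forall i, (t <= i)%N -> forall Y, H Y -> forall d : ext J i X Y, d = 0]].

(* [stable C] has the objects of [C], so that S is also the set of the objects of
   the subcategory M with stable_sub M = S. *)
Definition Psi (S : set (stable C)) : set C := right_perp J (S : set C).

Definition Phi (H : set C) : set (stable C) := stable_sub (H `&` left_perp J H).

End Bijection.

(* Main.v *)
From mathcomp Require Import all_boot all_algebra.
From mathcomp Require Import boolp classical_sets.
Require Import Defs.

(* Write G for the class of the objects that have a finite coresolution
   K -> M_0 -> ... -> M_n in M; it is orthogonal to H = M^perp, and it is closed under
   extensions by the horseshoe lemma.  For M silting, the key point is that every X
   has a conflation X -> B -> K with B in H and K in G.  Boundedness of every X with
   respect to M and H is a thick condition that holds on M, so it always holds; in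
   particular X[n] is in H for n large, and X -> I_0 -> ... -> X[n] is a finite
   coresolution in H.  The objects all of whose shifts, positive and negative, are so
   approximable also form a thick subcategory containing M.  Given the
   approximations, an object of H meet perp(H) is stably a summand of some M_0.

   Conversely, for H as in (2), approximating a syzygy of h in H and pushing out gives
   a conflation B -> Z -> h with B in H and Z in H meet perp(H); this lowers the bound
   t on the nonvanishing of E^i(h, H), so h is generated by H meet perp(H), and the
   finite coresolutions give all objects.  If Y is in (H meet perp(H))^perp, then
   E^i(perp(H), Y) vanishes for i large, because Y has a finite coresolution in H, and
   then for all i >= 1 by dimension shifting, so that Y -> B -> K splits. *)

Set Implicit Arguments.
Unset Strict Implicit.
Unset Printing Implicit Defensive.

Import GRing.Theory.

Local Open Scope ring_scope.
Local Open Scope classical_set_scope.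
Local Open Scope cat_scope.

(** * Exact sequences, pushouts and pullbacks *)

Section Exactness.
Variable C : extriangulated_category.
Implicit Types (A B K X Y Z P : C).

Definition biproduct_zero_r A Z (hZ : is_zero Z) : biproduct A Z.
Proof.
apply: (@Biproduct C A Z A (idc A) 0 (idc A) 0).
- exact: comp1c.
- by rewrite comp0c ((hZ Z).1 (idc Z)).
- exact: compc0.
- exact: comp0c.
- by rewrite comp1c compc0 addr0.
Defined.

Definition biproduct_zero_l A Z (hZ : is_zero Z) : biproduct Z A.
Proof.
apply: (@Biproduct C Z A A 0 (idc A) 0 (idc A)).
- by rewrite comp0c ((hZ Z).1 (idc Z)).
- exact: comp1c.
- exact: comp0c.
- exact: compc0.
- by rewrite comp1c compc0 add0r.
Defined.

(** The trivial conflations [A -> A -> 0] and [0 -> A -> A] serve as test objects: comparing a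
    conflation with them through [ET3], [ET3op] or [rlz_map] gives the exactness statements
    below. *)
Lemma realizes_idl A Z : is_zero Z -> realizes (idc A) (0 : hom A Z) (0 : ext1 Z A).
Proof. by move=> hZ; exact: (rlz0 (biproduct_zero_r A hZ)). Qed.

Lemma realizes_idr A Z : is_zero Z -> realizes (0 : hom Z A) (idc A) (0 : ext1 A Z).
Proof. by move=> hZ; exact: (rlz0 (biproduct_zero_l A hZ)). Qed.

Lemma push0c X A A' (d : ext1 X A) : push (0 : hom A A') d = 0.
Proof. by apply: (addrI (push 0 d)); rewrite -pushDl !addr0. Qed.

Lemma seq_equiv_refl A X (u : sequence A X) : seq_equiv u u.
Proof.
by exists (idc _); rewrite comp1c compc1; split=> //; exists (idc _); rewrite comp1c.
Qed.

Lemma is_iso_comp (D : preadditive_category) (A B X : D) (f : hom A B) (g : hom B X) :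
  is_iso f -> is_iso g -> is_iso (g \oc f).
Proof.
move=> [f' [f1 f2]] [g' [g1 g2]]; exists (f' \oc g'); split.
  by rewrite -compA (compA g') g1 comp1c.
by rewrite -compA (compA f) f2 comp1c.
Qed.

Lemma isomorphic_refl (D : preadditive_category) (A : D) : isomorphic A A.
Proof. by exists (idc A), (idc A); rewrite comp1c. Qed.

Lemma isomorphic_sym (D : preadditive_category) (A B : D) :
  isomorphic A B -> isomorphic B A.
Proof. by move=> [f [g [h1 h2]]]; exists g, f. Qed.

Lemma isomorphic_trans (D : preadditive_category) (A B X : D) :
  isomorphic A B -> isomorphic B X -> isomorphic A X.
Proof. by move=> [f hf] [g hg]; exists (g \oc f); exact: is_iso_comp. Qed.

Lemma seq_equiv_sym A X (u v : sequence A X) : seq_equiv u v -> seq_equiv v u.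
Proof.
move=> [b [[b' [h1 h2]] e1 e2]]; exists b'; split; first by exists b.
  by rewrite -e1 compA h1 comp1c.
by rewrite -e2 -compA h2 compc1.
Qed.

Lemma seq_equiv_trans A X (u v w : sequence A X) :
  seq_equiv u v -> seq_equiv v w -> seq_equiv u w.
Proof.
move=> [b [hb e1 e2]] [c [hc e3 e4]]; exists (c \oc b); split.
- exact: is_iso_comp.
- by rewrite -compA e1.
- by rewrite compA e4.
Qed.

Lemma realizes_exists A X (d : ext1 X A) :
  exists B (x : hom A B) (y : hom B X), realizes x y d.
Proof.
have [[B x y] hd] := rlz_class d; exists B, x, y.
by rewrite /realizes hd; exact: seq_equiv_refl.
Qed.

Lemma realizes_equiv A X (d : ext1 X A) (u v : sequence A X) :
  rlz d u -> rlz d v -> seq_equiv u v.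
Proof.
have [w ->] := rlz_class d => hu hv.
exact: seq_equiv_trans (seq_equiv_sym hu) hv.
Qed.

Lemma realizes_iso A X (d : ext1 X A) (u v : sequence A X) :
  seq_equiv u v -> rlz d u -> rlz d v.
Proof. by have [w ->] := rlz_class d => huv hu; exact: seq_equiv_trans huv. Qed.

Lemma conflation_mid_iso A B B' X (x : hom A B) (y : hom B X) :
  isomorphic B B' -> conflation x y ->
  exists (x' : hom A B') (y' : hom B' X), conflation x' y'.
Proof.
move=> [b [b' [h1 h2]]] [d hd]; exists (b \oc x), (y \oc b'), d.
apply: realizes_iso hd; exists b; split=> //=; first by exists b'.
by rewrite -compA h1 compc1.
Qed.

Lemma conflation_idl A Z : is_zero Z -> conflation (idc A) (0 : hom A Z).
Proof. by move=> hZ; exists 0; exact: realizes_idl. Qed.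

Lemma conflation_biproduct A B (S : biproduct A B) : conflation (injl S) (prr S).
Proof. by exists 0; exact: rlz0. Qed.

Lemma conflation_iso A B Z :
  is_zero Z -> isomorphic A B -> exists x : hom A B, conflation x (0 : hom B Z).
Proof.
move=> hZ hAB; have [x [y h]] := conflation_mid_iso hAB (conflation_idl A hZ).
by exists x; rewrite -((hZ B).1 y).
Qed.

(** * Exact sequences of Hom and E attached to a conflation *)

Section Conflation.
Variables (A B X : C) (x : hom A B) (y : hom B X) (d : ext1 X A).
Hypothesis hd : realizes x y d.

Lemma conflation_comp0 : y \oc x = 0.
Proof.
have [Z hZ] := zero_exists C.
have e : x \oc idc A = x \oc idc A by [].
have [c [hc _]] := ET3 (realizes_idl A hZ) hd e.
by rewrite -hc compc0.
Qed.

Lemma conflation_pull0 : pull y d = 0.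
Proof.
have [Z hZ] := zero_exists C.
have e : y \oc idc B = y \oc idc B by [].
have [a [_ <-]] := ET3op (realizes_idr B hZ) hd e.
exact: push0.
Qed.

Lemma conflation_desc Y (f : hom B Y) : f \oc x = 0 -> exists g : hom X Y, g \oc y = f.
Proof.
move=> hf; have [Z hZ] := zero_exists C.
have e : f \oc x = 0 \oc (0 : hom A Z) by rewrite hf compc0.
have [c [hc _]] := ET3 hd (realizes_idr Y hZ) e.
by exists c; rewrite hc comp1c.
Qed.

Lemma conflation_lift Y (f : hom Y B) : y \oc f = 0 -> exists g : hom Y A, x \oc g = f.
Proof.
move=> hf; have [Z hZ] := zero_exists C.
have e : (0 : hom Z X) \oc (0 : hom Y Z) = y \oc f by rewrite hf compc0.
have [c [hc _]] := ET3op (realizes_idl Y hZ) hd e.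
by exists c; rewrite -hc compc1.
Qed.

Lemma push0_extend Y (f : hom A Y) : push f d = 0 -> exists g : hom B Y, g \oc x = f.
Proof.
move=> hf; have [Z hZ] := zero_exists C.
have e : push f d = pull (0 : hom X Z) (0 : ext1 Z Y) by rewrite hf pull0.
have [b [hb _]] := rlz_map hd (realizes_idl Y hZ) e.
by exists b; rewrite hb comp1c.
Qed.

Lemma pull0_lift Y (f : hom Y X) : pull f d = 0 -> exists g : hom Y B, y \oc g = f.
Proof.
move=> hf; have [Z hZ] := zero_exists C.
have e : push (0 : hom Z A) (0 : ext1 Y Z) = pull f d by rewrite hf push0.
have [b [_ hb]] := rlz_map (realizes_idr Y hZ) hd e.
by exists b; rewrite hb compc1.
Qed.

(** Exactness at [E(X, Y)]: the vanishing lets [y] lift through the deflation [y'] of [d'], and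
    [ET3op] completes the lift to a morphism of conflations whose first component is [f]. *)
Lemma pull0_push Y (d' : ext1 X Y) : pull y d' = 0 -> exists f : hom A Y, d' = push f d.
Proof.
move=> hd'; have [Z [x' [y' h']]] := realizes_exists d'.
have [Z0 hZ] := zero_exists C.
have e : push (0 : hom Z0 Y) (0 : ext1 B Z0) = pull y d' by rewrite hd' push0.
have [b [_ hb]] := rlz_map (realizes_idr B hZ) h' e.
have e' : idc X \oc y = y' \oc b by rewrite hb comp1c compc1.
have [a [_ ha]] := ET3op hd h' e'.
by exists a; rewrite ha pull1.
Qed.

Lemma push0_pull Y (d' : ext1 Y A) : push x d' = 0 -> exists f : hom Y X, d' = pull f d.
Proof.
move=> hd'; have [Z [x' [y' h']]] := realizes_exists d'.
have [Z0 hZ] := zero_exists C.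
have e : push x d' = pull (0 : hom Y Z0) (0 : ext1 Z0 B) by rewrite hd' pull0.
have [b [hb _]] := rlz_map h' (realizes_idl B hZ) e.
have e' : b \oc x' = x \oc idc A by rewrite hb comp1c compc1.
have [c [_ hc]] := ET3 h' hd e'.
by exists c; rewrite -hc push1.
Qed.

(** Exactness at [E(B, Y)]: by [ET4op] the composite deflation [Z -> B -> X] has a cocone [E] that
    extends [A] by [Y] with class [pull x d' = 0]. A retraction of [Y -> E] carries the class [d3]
    of [E -> Z -> X] to the required element. *)
Lemma pull_exact Y (d' : ext1 B Y) : pull x d' = 0 -> exists e : ext1 X Y, d' = pull y e.
Proof.
move=> hd'; have [Z [g [g' h']]] := realizes_exists d'.
have [E [h1 [u [e [d3 [_ [hue _ hd3]]]]]]] := ET4op hd h'.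
have hs : exists s : hom E Y, s \oc e = idc Y.
  rewrite hd' in hue; have [Z0 hZ] := zero_exists C.
  have e0 : push (idc Y) 0 = pull (0 : hom A Z0) (0 : ext1 Z0 Y) by rewrite pull0 push1.
  have [b [hb _]] := rlz_map hue (realizes_idl Y hZ) e0.
  by exists b; rewrite hb compc1.
have [s es] := hs.
by exists (push s d3); rewrite -push_pull hd3 -push_comp es push1.
Qed.

End Conflation.

(** * Uniqueness of middle terms, pushouts and pullbacks *)

Lemma split_conflation A B X (x : hom A B) (y : hom B X) (S : biproduct A X) :
  realizes x y 0 -> isomorphic S B.
Proof. by move=> h; have [b [hb _ _]] := realizes_equiv (rlz0 S) h; exists b. Qed.

Definition biproduct_iso (D : preadditive_category) (A B : D) (S : biproduct A B) (T : D)
    (f : hom S T) (g : hom T S) (gf : g \oc f = idc _) (fg : f \oc g = idc T) :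
  biproduct A B.
Proof.
apply: (@Biproduct D A B T (f \oc injl S) (f \oc injr S) (prl S \oc g) (prr S \oc g)).
- by rewrite -compA (compA g) gf comp1c prl_inl.
- by rewrite -compA (compA g) gf comp1c prr_inr.
- by rewrite -compA (compA g) gf comp1c prl_inr.
- by rewrite -compA (compA g) gf comp1c prr_inl.
- by rewrite !compA -!compDl -!(compA f) -compDr bip_id compc1.
Defined.

Definition biproduct_swap (D : preadditive_category) (A B : D) (S : biproduct A B) :
  biproduct B A.
Proof.
apply: (@Biproduct D B A S (injr S) (injl S) (prr S) (prl S)).
- exact: prr_inr.
- exact: prl_inl.
- exact: prr_inl.
- exact: prl_inr.
- by rewrite addrC bip_id.
Defined.

Lemma biproduct_unique (D : preadditive_category) (A A' B B' : D)
    (S : biproduct A B) (S' : biproduct A' B') :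
  isomorphic A A' -> isomorphic B B' -> isomorphic S S'.
Proof.
move=> [a [a' [a1 a2]]] [b [b' [b1 b2]]]; exists (bimap S S' a b), (bimap S' S a' b').
rewrite /bimap; split.
- rewrite !(compDl, compDr) -!compA !(compA (prl S')) !(compA (prr S')).
  rewrite prl_inl prr_inr prl_inr prr_inl !(comp0c, comp1c, compc0, addr0, add0r).
  by rewrite (compA a') (compA b') a1 b1 !comp1c bip_id.
- rewrite !(compDl, compDr) -!compA !(compA (prl S)) !(compA (prr S)).
  rewrite prl_inl prr_inr prl_inr prr_inl !(comp0c, comp1c, compc0, addr0, add0r).
  by rewrite (compA a) (compA b) a2 b2 !comp1c bip_id.
Qed.

Lemma realizes_mid_unique A B B' X (x : hom A B) (y : hom B X) (x' : hom A B')
    (y' : hom B' X) (d : ext1 X A) :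
  realizes x y d -> realizes x' y' d ->
  exists (b : hom B B') (b' : hom B' B),
    [/\ b' \oc b = idc B, b \oc b' = idc B', b \oc x = x' & y' \oc b = y].
Proof.
move=> h h'; have [b [[b' [h1 h2]] h3 h4]] := realizes_equiv h h'.
by exists b, b'.
Qed.

(** The difference [n = b - idc B] factors both through [y] and through [x], so [n \oc n = 0] and
    [idc B - n] is the inverse. *)
Lemma realizes_endo_iso A B X (x : hom A B) (y : hom B X) (d : ext1 X A) (b : hom B B) :
  realizes x y d -> b \oc x = x -> y \oc b = y -> is_iso b.
Proof.
move=> h h1 h2; pose n := b - idc B.
have nx : n \oc x = 0 by rewrite compBl h1 comp1c subrr.
have yn : y \oc n = 0 by rewrite compBr h2 compc1 subrr.
have [p hp] := conflation_desc h nx; have [q hq] := conflation_lift h yn.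
have nn : n \oc n = 0.
  by rewrite -{1}hp -{1}hq -compA (compA y) (conflation_comp0 h) comp0c compc0.
have -> : b = idc B + n by rewrite addrC subrK.
move: n nn {nx yn hp hq} => n nn.
exists (idc B - n); rewrite !(compBl, compBr, compDl, compDr) !(comp1c, compc1) nn.
by rewrite addr0 addrK.
Qed.

Lemma is_iso_of_comp A B (f : hom A B) (g : hom B A) :
  is_iso (g \oc f) -> is_iso (f \oc g) -> is_iso f.
Proof.
move=> [u [u1 _]] [v [_ v2]].
have e : u \oc g = g \oc v.
  by rewrite -[RHS]comp1c -u1 -!compA (compA f) v2 compc1.
by exists (u \oc g); split; [rewrite -compA u1 | rewrite e compA v2].
Qed.

(** The comparison maps in the two directions compose to endomorphisms that respect both ends, hence
    to isomorphisms by [realizes_endo_iso]. *)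
Lemma realizes_push_iso A A' B X (x : hom A B) (y : hom B X) (d : ext1 X A)
    (c : hom A A') (c' : hom A' A) :
  c' \oc c = idc A -> c \oc c' = idc A' -> realizes x y d ->
  realizes (x \oc c') y (push c d).
Proof.
move=> c1 c2 h; have [B1 [x1 [y1 h1]]] := realizes_exists (push c d).
have e1 : push c d = pull (idc X) (push c d) by rewrite pull1.
have [b [bx yb]] := rlz_map h h1 e1.
have e2 : push c' (push c d) = pull (idc X) d by rewrite -push_comp c1 push1 pull1.
have [b' [bx' yb']] := rlz_map h1 h e2.
apply: (realizes_iso _ h1); exists b'; split=> //=; last by rewrite yb' comp1c.
apply: (@is_iso_of_comp _ _ _ b).
  apply: (realizes_endo_iso h1); last by rewrite compA yb comp1c yb' comp1c.
  by rewrite -compA bx' compA bx -compA c2 compc1.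
apply: (realizes_endo_iso h); last by rewrite compA yb' comp1c yb comp1c.
by rewrite -compA bx compA bx' -compA c1 compc1.
Qed.

Lemma realizes_pull_iso A B X X' (x : hom A B) (y : hom B X) (d : ext1 X A)
    (c : hom X X') (c' : hom X' X) :
  c' \oc c = idc X -> c \oc c' = idc X' -> realizes x y d ->
  realizes x (c \oc y) (pull c' d).
Proof.
move=> c1 c2 h; have [B1 [x1 [y1 h1]]] := realizes_exists (pull c' d).
have e1 : push (idc A) d = pull c (pull c' d) by rewrite push1 -pull_comp c1 pull1.
have [b [bx yb]] := rlz_map h h1 e1.
have e2 : push (idc A) (pull c' d) = pull c' d by rewrite push1.
have [b' [bx' yb']] := rlz_map h1 h e2.
apply: (realizes_iso _ h1); exists b'; split=> /=.
- apply: (@is_iso_of_comp _ _ _ b).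
    apply: (realizes_endo_iso h1); first by rewrite -compA bx' compA bx !compc1.
    by rewrite compA yb -compA yb' compA c2 comp1c.
  apply: (realizes_endo_iso h); first by rewrite -compA bx compA bx' !compc1.
  by rewrite compA yb' -compA yb compA c1 comp1c.
- by rewrite bx' compc1.
- by rewrite -compA yb' compA c2 comp1c.
Qed.

(** [Z] is the middle term of the extension of [X (+) X'] by [A] with class [(d, d')]. The cocone of
    [Z -> X] is an extension of [X'] by [A] with class [d'], hence is [B']; exchanging the summands
    gives the other conflation. *)
Lemma pushout_conflation A B B' X X' (x : hom A B) (y : hom B X) (d : ext1 X A)
    (x' : hom A B') (y' : hom B' X') (d' : ext1 X' A) :
  realizes x y d -> realizes x' y' d' ->
  exists Z (u : hom B Z) (v : hom Z X') (u' : hom B' Z) (v' : hom Z X),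
    realizes u v (push x d') /\ realizes u' v' (push x' d).
Proof.
move=> h h'; have [S] := biproduct_exists X X'.
have [Z [g' [g hg]]] := realizes_exists (pull (prl S) d + pull (prr S) d').
have key (Y Y' A' : C) (T : biproduct Y Y') (e : ext1 Y A) (e' : ext1 Y' A) (w : hom A A')
    (w' : hom A' Y') (p : hom Z T) :
    realizes w w' e' -> realizes g' p (pull (prl T) e + pull (prr T) e') ->
    exists (u' : hom A' Z) (v' : hom Z Y), realizes u' v' (push w e).
  move=> hw hp.
  have [E [k [a [b [d3 [[_ _ hk] [hE _ hd3]]]]]]] :=
    ET4op (rlz0 (biproduct_swap T)) hp.
  move: hE; rewrite /= pullDr -!pull_comp prl_inr prr_inr pull0c pull1 add0r => hE.
  have [c [c' [c1 c2 c3 c4]]] := realizes_mid_unique hE hw.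
  exists (k \oc c'), (prl T \oc p).
  have -> : push w e = push c d3.
    rewrite -c3 push_comp; congr push.
    have := congr1 (pull (injl T)) hd3.
    rewrite /= -!pull_comp prl_inl pull1 -push_pull pullDr -!pull_comp prl_inl prr_inl.
    by rewrite pull1 pull0c addr0.
  have := realizes_push_iso c1 c2 hk.
  rewrite /= -(comp1c (prl T)).
  done.
have e : pull (prl S) d + pull (prr S) d' =
         pull (prl (biproduct_swap S)) d' + pull (prr (biproduct_swap S)) d.
  exact: addrC.
have hg' := hg; rewrite e in hg'.
have [u' [v' huv']] := key X X' B' S d d' x' y' g h' hg.
have [u [v huv]] := key X' X B (biproduct_swap S) d' d x y g h hg'.
by exists Z, u, v, u', v'.
Qed.

(** Dually, [Z] is the middle term of the extension of [X] by [A (+) A'] with class [(d, d')]. *)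
Lemma pullback_conflation A A' B B' X (x : hom A B) (y : hom B X) (d : ext1 X A)
    (x' : hom A' B') (y' : hom B' X) (d' : ext1 X A') :
  realizes x y d -> realizes x' y' d' ->
  exists Z (u : hom A' Z) (v : hom Z B) (u' : hom A Z) (v' : hom Z B'),
    realizes u v (pull y d') /\ realizes u' v' (pull y' d).
Proof.
move=> h h'; have [S] := biproduct_exists A A'.
have [Z [g [g' hg]]] := realizes_exists (push (injl S) d + push (injr S) d').
have key (Y Y' X' : C) (T : biproduct Y Y') (e : ext1 X Y) (e' : ext1 X Y') (w : hom Y' X')
    (w' : hom X' X) (p : hom T Z) :
    realizes w w' e' -> realizes p g' (push (injl T) e + push (injr T) e') ->
    exists (u' : hom Y Z) (v' : hom Z X'), realizes u' v' (pull w' e).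
  move=> hw hp.
  have [E [k [a [b [d3 [[_ _ hk] [hE _ hd3]]]]]]] := ET4 (rlz0 T) hp.
  move: hE; rewrite /= pushDr -!push_comp prr_inl prr_inr push0c push1 add0r => hE.
  have [c [c' [c1 c2 c3 c4]]] := realizes_mid_unique hE hw.
  exists (p \oc injl T), (c \oc k).
  have -> : pull w' e = pull c' d3.
    have -> : w' = b \oc c' by rewrite -c4 -compA c2 compc1.
    rewrite pull_comp; congr pull.
    have := congr1 (push (prl T)) hd3.
    rewrite /= -!push_comp prl_inl push1 push_pull pushDr -!push_comp prl_inl prl_inr.
    by rewrite push1 push0c addr0.
  exact: realizes_pull_iso c1 c2 hk.
have e : push (injl S) d + push (injr S) d' =
         push (injl (biproduct_swap S)) d' + push (injr (biproduct_swap S)) d.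
  exact: addrC.
have hg' := hg; rewrite e in hg'.
have [u' [v' huv']] := key A A' B' S d d' x' y' g h' hg.
have [u [v huv]] := key A' A B (biproduct_swap S) d' d x y g h hg'.
by exists Z, u, v, u', v'.
Qed.

End Exactness.

(** * The stable category *)

Section StableIso.
Variable C : extriangulated_category.
Implicit Types (A B K X Y Z P : C).

Definition stable_iso A B : Prop := @isomorphic (stable C) A B.

Definition stable_zero_hom A B : Prop := forall f : hom A B, via_proj f.

Lemma via_projP A B (f : hom A B) :
  via_proj f <-> exists P (g : hom P B) (h : hom A P), projective P /\ f = g \oc h.
Proof. by split=> [/asboolP|?]; last exact/asboolP. Qed.

Lemma via_proj_comp A B P (g : hom P B) (h : hom A P) : projective P -> via_proj (g \oc h).
Proof. by move=> hP; apply/via_projP; exists P, g, h. Qed.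

Lemma via_projD A B (f g : hom A B) : via_proj f -> via_proj g -> via_proj (f + g).
Proof. by move=> hf hg; exact: (@rpredD _ (proj_ideal A B) f g hf hg). Qed.

Lemma via_projN A B (f : hom A B) : via_proj f -> via_proj (- f).
Proof. by move=> hf; rewrite -[_ (- f)]/(- f \in proj_ideal A B) rpredN. Qed.

Lemma via_projBr A B (f g : hom A B) : via_proj (f - g) -> via_proj f -> via_proj g.
Proof.
move=> h hf; rewrite -(opprK g) -(addKr f (- g)) opprD opprK.
by apply: via_projD => //; exact: via_projN.
Qed.

Lemma via_proj_cls A B (f : hom A B) : via_proj f <-> cls f = 0.
Proof. by rewrite -cls0 clsE subr0. Qed.

Lemma stable_isoP A B : stable_iso A B <->
  exists (f : hom A B) (g : hom B A),
    via_proj (g \oc f - idc A) /\ via_proj (f \oc g - idc B).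
Proof.
split=> [[u [v [h1 h2]]]|[f [g [/clsE h1 /clsE h2]]]].
  exists (repr u), (repr v); split; apply/clsE; rewrite -stable_compE.
    by rewrite !(@cls_repr C).
  by rewrite !(@cls_repr C).
exists (cls f : @hom (stable C) A B), (cls g : @hom (stable C) B A).
by rewrite /= !stable_compE h1 h2.
Qed.

Lemma isomorphic_stable A B : isomorphic A B -> stable_iso A B.
Proof.
move=> [f [g [h1 h2]]]; apply/stable_isoP; exists f, g.
by rewrite h1 h2 !subrr; split; apply/via_proj_cls; exact: cls0.
Qed.

Lemma stable_iso_refl A : stable_iso A A.
Proof. exact: isomorphic_refl. Qed.

Lemma stable_iso_sym A B : stable_iso A B -> stable_iso B A.
Proof. exact: isomorphic_sym. Qed.

Lemma stable_iso_trans B A X : stable_iso A B -> stable_iso B X -> stable_iso A X.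
Proof. exact: isomorphic_trans. Qed.

Lemma stable_iso_sum_proj A P (S : biproduct A P) : projective P -> stable_iso S A.
Proof.
move=> hP; apply/stable_isoP; exists (prl S), (injl S); split.
  by rewrite -(bip_id S) opprD addrA subrr add0r; apply: via_projN; exact: via_proj_comp.
by rewrite prl_inl subrr; apply/via_proj_cls; exact: cls0.
Qed.

Lemma stable_zero_homl A A' Y :
  stable_iso A A' -> stable_zero_hom A Y -> stable_zero_hom A' Y.
Proof.
move=> /stable_isoP[f [g [_ h]]] hA k.
apply: via_projBr (_ : via_proj (k \oc f \oc g)).
  by rewrite -compA -{2}(compc1 k) -compBr; exact: via_proj_compl.
by apply: via_proj_compr; exact: hA.
Qed.

Lemma stable_zero_homr A A' Y :
  stable_iso A A' -> stable_zero_hom Y A -> stable_zero_hom Y A'.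
Proof.
move=> /stable_isoP[f [g [_ h]]] hA k.
apply: via_projBr (_ : via_proj (f \oc (g \oc k))).
  by rewrite compA -{2}(comp1c k) -compBl; exact: via_proj_compr.
by apply: via_proj_compl; exact: hA.
Qed.

Lemma stable_zero_hom_projl P Y : projective P -> stable_zero_hom P Y.
Proof. by move=> hP f; rewrite -(compc1 f); exact: via_proj_comp. Qed.

Lemma stable_zero_hom_projr P Y : projective P -> stable_zero_hom Y P.
Proof. by move=> hP f; rewrite -(comp1c f); exact: via_proj_comp. Qed.

Definition stable_biproduct A B (T : biproduct A B) : @biproduct (stable C) A B.
Proof.
apply: (@Biproduct (stable C) A B (bip_obj T) (cls (injl T)) (cls (injr T))
  (cls (prl T)) (cls (prr T))); rewrite /= ?stable_compE.
- by rewrite prl_inl.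
- by rewrite prr_inr.
- by rewrite prl_inr cls0.
- by rewrite prr_inl cls0.
- by rewrite -clsD bip_id.
Defined.

Lemma stable_biproductE A B (S : @biproduct (stable C) A B) (T : biproduct A B) :
  stable_iso S T.
Proof. by apply: (biproduct_unique S (stable_biproduct T)); exact: isomorphic_refl. Qed.

Lemma stable_iso_biproduct A A' B B' (S : biproduct A B) (S' : biproduct A' B') :
  stable_iso A A' -> stable_iso B B' -> stable_iso S S'.
Proof. exact: (biproduct_unique (stable_biproduct S) (stable_biproduct S')). Qed.

End StableIso.

(** * Cosyzygies as the shift on stable morphisms *)

Section Cosyzygies.
Variable C : extriangulated_category.
Hypothesis hPI : Proj C = Inj C.
Implicit Types (A B K X Y Z P : C).

Lemma proj_injE P : projective P <-> injective_obj P.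
Proof. by have /= := congr1 (fun S : set C => S P) hPI; rewrite /Proj /Inj /= => ->. Qed.

Section Shift.
Variables (A I A' : C) (i : hom A I) (p : hom I A') (d : ext1 A' A).
Variables (B J B' : C) (j : hom B J) (q : hom J B') (e : ext1 B' B).
Hypotheses (hd : realizes i p d) (he : realizes j q e).
Hypotheses (hI : projective I) (hJ : projective J).

Lemma cosyzygy_map (f : hom A B) : exists g : hom A' B', push f d = pull g e.
Proof. by apply: (push0_pull he); apply: ((proj_injE J).1 hJ). Qed.

Lemma syzygy_map (g : hom A' B') : exists f : hom A B, push f d = pull g e.
Proof.
have [f hf] : exists f : hom A B, pull g e = push f d by apply: (pull0_push hd); exact: hI.
by exists f.
Qed.

(** Both sides say that the common class [push f d = pull g e] is zero: projectives are also
    injective, so a factorization kills the class; conversely a zero class lets [g] lift to [J] or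
    [f] extend to [I]. *)
Lemma via_proj_shift (f : hom A B) (g : hom A' B') :
  push f d = pull g e -> (via_proj f <-> via_proj g).
Proof.
move=> h; split=> /via_projP[P [u [v [hP euv]]]].
  have : pull g e = 0.
    by rewrite -h euv push_comp ((proj_injE P).1 hP _ (push v d)) push0.
  by move=> /(pull0_lift he)[k <-]; exact: via_proj_comp.
have : push f d = 0 by rewrite h euv pull_comp (hP _ (pull u e)) pull0.
by move=> /(push0_extend hd)[k <-]; exact: via_proj_comp.
Qed.

Lemma stable_zero_hom_shift : stable_zero_hom A B <-> stable_zero_hom A' B'.
Proof.
split=> h f.
  by have [g hg] := syzygy_map f; apply/(via_proj_shift hg); exact: h.
by have [g hg] := cosyzygy_map f; apply/(via_proj_shift hg); exact: h.
Qed.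

End Shift.

(** The middle terms are arbitrary projectives and not only the chosen hulls, so that projective
    covers, sums of hulls and different choices can all be compared. *)
Lemma stable_iso_shift A I A' (i : hom A I) (p : hom I A') (d : ext1 A' A)
    B J B' (j : hom B J) (q : hom J B') (e : ext1 B' B) :
  realizes i p d -> realizes j q e -> projective I -> projective J ->
  (stable_iso A B <-> stable_iso A' B').
Proof.
move=> hd he hI hJ; split=> /stable_isoP[f [g [h1 h2]]]; apply/stable_isoP.
  have [f' hf] := cosyzygy_map d he hJ f; have [g' hg] := cosyzygy_map e hd hI g.
  exists f', g'; split.
    apply: proj1 (via_proj_shift hd hd hI hI _) h1.
    by rewrite pushDl pullDl pushNc pullNc push1 pull1 push_comp pull_comp hf push_pull hg.
  apply: proj1 (via_proj_shift he he hJ hJ _) h2.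
  by rewrite pushDl pullDl pushNc pullNc push1 pull1 push_comp pull_comp hg push_pull hf.
have [f' hf] := syzygy_map e hd hI f; have [g' hg] := syzygy_map d he hJ g.
exists f', g'; split.
  apply: proj2 (via_proj_shift hd hd hI hI _) h1.
  by rewrite pushDl pullDl pushNc pullNc push1 pull1 push_comp pull_comp hf push_pull hg.
apply: proj2 (via_proj_shift he he hJ hJ _) h2.
by rewrite pushDl pullDl pushNc pullNc push1 pull1 push_comp pull_comp hg push_pull hf.
Qed.

(** The connecting map [g |-> pull g e] onto [E(X, Y)] is surjective because [I] is injective, and
    its kernel consists of the morphisms through projectives. *)
Lemma ext1_eq0E X Y I Y' (i : hom Y I) (p : hom I Y') :
  conflation i p -> projective I ->
  ((forall d : ext1 X Y, d = 0) <-> stable_zero_hom X Y').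
Proof.
move=> [e he] hI; split=> [h g|h d].
  by have [k <-] := pull0_lift he (h (pull g e)); exact: via_proj_comp.
have [g ->] : exists g, d = pull g e.
  by apply: (push0_pull he); apply: ((proj_injE I).1 hI).
have /via_projP[P [u [v [hP ->]]]] := h g.
by rewrite pull_comp (hP _ (pull u e)) pull0.
Qed.

(* The middle term is B (+) I because the extension of I by B in the pullback splits. *)
Lemma stable_iso_conflation A I A' (i : hom A I) (p : hom I A') B :
  conflation i p -> projective I -> stable_iso A B ->
  exists (Q : C) (S : biproduct B I) (u : hom A S) (v : hom S Q),
    conflation u v /\ projective Q.
Proof.
move=> [d hd] hI /stable_isoP[f [g [h1 h2]]].
have [Q [b [q hbq]]] := realizes_exists (push f d).
have [E [u [v [b' [w [hu hb']]]]]] := pullback_conflation hbq hd.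
have [S0] := biproduct_exists B I.
have hpf : pull p (push f d) = 0 by rewrite -push_pull (conflation_pull0 hd) push0.
rewrite hpf in hb'.
have [s [s' [hs1 hs2]]] := split_conflation S0 hb'.
exists Q, (biproduct_iso hs1 hs2), u, v.
split; first by exists (pull q d).
(* [Q] is projective: stable invertibility of [f] first gives [pull b c = 0], so that [c] comes from
   a class [push k d]; this class equals [push (k \oc g) (push f d)], which [pull q] kills. *)
move=> Y c.
have hq : pull b c = 0.
  have e : push f d = pull (idc A') (push f d) by rewrite pull1.
  have [r [hr _]] := rlz_map hd hbq e.
  have h0 : pull f (pull b c) = 0 by rewrite -pull_comp -hr pull_comp (hI _ (pull r c)) pull0.
  have /via_projP[P [k [l [hP ekl]]]] := h2.
  have : pull (f \oc g - idc B) (pull b c) = 0.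
    by rewrite ekl pull_comp (hP _ (pull k _)) pull0.
  rewrite pullDl pullNc pull1 pull_comp h0 pull0 add0r => /eqP.
  by rewrite oppr_eq0 => /eqP.
have [c1 hc1] := pull_exact hbq hq.
have [k hk] : exists k : hom A Y, c1 = push k d.
  by apply: (pull0_push hd); exact: hI.
have : push (k \oc (g \oc f - idc A)) d = 0.
  have /via_projP[P [l [m [hP ->]]]] := h1.
  by rewrite !push_comp ((proj_injE P).1 hP _ (push m d)) !push0.
rewrite compBr compc1 pushDl pushNc compA hc1 hk => /subr0_eq <-.
by rewrite push_comp -push_pull (conflation_pull0 hbq) push0.
Qed.

End Cosyzygies.

(** * Triangles of the stable category, on objects *)

Section StableTriangulation.
Variables (C : extriangulated_category) (J : cosyzygy_choice C).
Hypothesis hC : frobenius C.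
Implicit Types (A B K X Y Z P : C) (U : set C).

Local Notation Sg := (Sigma J).

Lemma frobenius_proj_inj : Proj C = Inj C.
Proof. by have [] := hC. Qed.

Let hPI := frobenius_proj_inj.

Lemma hull_projective A : projective (hull J A).
Proof. by apply/(proj_injE hPI); exact: hull_injective. Qed.

Arguments hull_projective : clear implicits.

Lemma conflation_hull A : conflation (hull_in J A) (hull_out J A).
Proof. by exists (delta J A); exact: delta_realized. Qed.

Lemma stable_zero_hom_Sigma X Y :
  stable_zero_hom X Y <-> stable_zero_hom (Sg X) (Sg Y).
Proof.
by apply: (stable_zero_hom_shift hPI (delta_realized J X) (delta_realized J Y));
  exact: hull_projective.
Qed.

Lemma ext1_eq0_Sigma X Y : (forall d : ext1 X Y, d = 0) <-> stable_zero_hom X (Sg Y).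
Proof. exact: (ext1_eq0E hPI X (conflation_hull Y) (hull_projective Y)). Qed.

Lemma ext_eq0E i X Y : (0 < i)%N ->
  (forall d : ext J i X Y, d = 0) <-> stable_zero_hom X (iter i Sg Y).
Proof. by case: i => // i _; exact: ext1_eq0_Sigma. Qed.

Lemma stable_iso_Sigma A B : stable_iso A B <-> stable_iso (Sg A) (Sg B).
Proof.
by apply: (stable_iso_shift hPI (delta_realized J A) (delta_realized J B));
  exact: hull_projective.
Qed.

Lemma stable_iso_iter n A B :
  stable_iso A B <-> stable_iso (iter n Sg A) (iter n Sg B).
Proof. by elim: n => //= n IH; rewrite IH stable_iso_Sigma. Qed.

Lemma Sigma_surj X : exists Z, stable_iso (Sg Z) X.
Proof.
have [hP _ _] := hC; have [Z [P [x [y [hp [d hd]]]]]] := hP X; exists Z.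
apply: (stable_iso_shift hPI (delta_realized J Z) hd _ hp).1 (stable_iso_refl Z).
exact: hull_projective.
Qed.

Lemma iter_Sigma_surj n X : exists Z, stable_iso (iter n Sg Z) X.
Proof.
elim: n X => [|n IH] X; first by exists X; exact: stable_iso_refl.
have [Y hY] := Sigma_surj X; have [Z hZ] := IH Y; exists Z.
by apply: stable_iso_trans hY; exact: (stable_iso_Sigma _ _).1 hZ.
Qed.

Lemma stable_iso_Sigma_sum A B (S : biproduct A B) (T : biproduct (Sg A) (Sg B)) :
  stable_iso (Sg S) T.
Proof.
have [H] := biproduct_exists (hull J A) (hull J B).
have h := rlz_sum S H T (delta_realized J A) (delta_realized J B).
apply: (stable_iso_shift hPI (delta_realized J S) h _ _).1 (stable_iso_refl S).
  exact: hull_projective.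
by apply: projective_sum; exact: hull_projective.
Qed.

Lemma stable_iso_iter_sum n A B (S : biproduct A B)
    (T : biproduct (iter n Sg A) (iter n Sg B)) :
  stable_iso (iter n Sg S) T.
Proof.
elim: n T => [|n IH] T /=.
  by apply: isomorphic_stable; apply: biproduct_unique; exact: isomorphic_refl.
have [T'] := biproduct_exists (iter n Sg A) (iter n Sg B).
by apply: stable_iso_trans (stable_iso_Sigma_sum T' T); apply: (stable_iso_Sigma _ _).1; exact: IH.
Qed.

(* The triangles of the stable category without their morphisms; orthogonality and
   closure conditions only involve the objects. *)
Definition triangle A B X : Prop :=
  exists A' B' X' (x : hom A' B') (y : hom B' X'),
    conflation x y /\ [/\ stable_iso A' A, stable_iso B' B & stable_iso X' X].

Lemma triangle_conflation A B X (x : hom A B) (y : hom B X) :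
  conflation x y -> triangle A B X.
Proof. by move=> h; exists A, B, X, x, y; split=> //; split; exact: stable_iso_refl. Qed.

Lemma triangle_iso A B X A' B' X' : stable_iso A A' -> stable_iso B B' ->
  stable_iso X X' -> triangle A B X -> triangle A' B' X'.
Proof.
move=> hA hB hX [A0 [B0 [X0 [x [y [h [h1 h2 h3]]]]]]]; exists A0, B0, X0, x, y.
by split=> //; split; [exact: stable_iso_trans hA|exact: stable_iso_trans hB
  |exact: stable_iso_trans hX].
Qed.

Lemma split_stable_isol P B X (x : hom P B) (y : hom B X) :
  projective P -> conflation x y -> stable_iso B X.
Proof.
move=> hP [d hd]; rewrite ((proj_injE hPI P).1 hP _ d) in hd.
have [S] := biproduct_exists P X.
apply: stable_iso_trans (stable_iso_sum_proj (biproduct_swap S) hP).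
exact/isomorphic_stable/isomorphic_sym/(split_conflation S hd).
Qed.

Lemma split_stable_isor P B A (x : hom A B) (y : hom B P) :
  projective P -> conflation x y -> stable_iso B A.
Proof.
move=> hP [d hd]; rewrite (hP _ d) in hd.
have [S] := biproduct_exists A P.
apply: stable_iso_trans (stable_iso_sum_proj S hP).
exact/isomorphic_stable/isomorphic_sym/(split_conflation S hd).
Qed.

(** Forwards, push out along the hull of [A']: the new middle term differs from [X'] by a
    projective. Backwards, pull back along a projective cover of [Y], whose syzygy is a
    desuspension. *)
Lemma triangle_rot A B X : triangle A B X <-> triangle B X (Sg A).
Proof.
split=> [[A' [B' [X' [x [y [[d hd] [hA hB hX]]]]]]]|[B' [X' [Y [x [y [[d hd] [hB hX hY]]]]]]]].
  have [Z [u [v [u' [v' [h1 h2]]]]]] := pushout_conflation hd (delta_realized J A').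
  exists B', Z, (Sg A'), u, v; split; first by eexists; exact: h1.
  split=> //; last exact: (stable_iso_Sigma _ _).1 hA.
  apply: stable_iso_trans hX; apply: split_stable_isol (hull_projective A') _.
  by eexists; exact: h2.
have [hP _ _] := hC; have [W [P [i [p [hp [e he]]]]]] := hP Y.
have [Z [u [v [u' [v' [h1 h2]]]]]] := pullback_conflation hd he.
exists W, Z, X', u, v; split; first by eexists; exact: h1.
split=> //.
  apply: (stable_iso_shift hPI he (delta_realized J A) hp _).2 hY.
  exact: hull_projective.
apply: stable_iso_trans hB; apply: split_stable_isor hp _.
by eexists; exact: h2.
Qed.

Lemma triangle_Sigma A B X : triangle A B X <-> triangle (Sg A) (Sg B) (Sg X).
Proof. by rewrite triangle_rot triangle_rot triangle_rot. Qed.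

Lemma triangle_iter n A B X :
  triangle A B X <-> triangle (iter n Sg A) (iter n Sg B) (iter n Sg X).
Proof. by elim: n => //= n IH; rewrite IH triangle_Sigma. Qed.

(** Lifting to [B'] the projective through which [y \oc f] factors corrects [f], modulo projectives,
    to a morphism killed by [y], which factors through [A']. *)
Lemma stable_zero_hom_mid A B X Y : triangle A B X ->
  stable_zero_hom Y A -> stable_zero_hom Y X -> stable_zero_hom Y B.
Proof.
move=> [A' [B' [X' [x [y [[d hd] [hA hB hX]]]]]]].
move=> /(stable_zero_homr (stable_iso_sym hA)) h1 /(stable_zero_homr (stable_iso_sym hX)) h2.
apply: stable_zero_homr hB _ => f.
have /via_projP[P [u [v [hP e]]]] := h2 (y \oc f).
have [w hw] := pull0_lift hd (hP _ (pull u d)).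
have [g hg] : exists g, x \oc g = f - w \oc v.
  by apply: (conflation_lift hd); rewrite compBr compA hw e subrr.
rewrite -(subrK (w \oc v) f) -hg; apply: via_projD; last exact: via_proj_comp.
by apply: via_proj_compl; exact: h1.
Qed.

Lemma stable_zero_hom_comid A B X Y : triangle A B X ->
  stable_zero_hom A Y -> stable_zero_hom X Y -> stable_zero_hom B Y.
Proof.
move=> [A' [B' [X' [x [y [[d hd] [hA hB hX]]]]]]].
move=> /(stable_zero_homl (stable_iso_sym hA)) h1 /(stable_zero_homl (stable_iso_sym hX)) h2.
apply: stable_zero_homl hB _ => f.
have /via_projP[P [u [v [hP e]]]] := h1 (f \oc x).
have [w hw] := push0_extend hd ((proj_injE hPI P).1 hP _ (push v d)).
have [g hg] : exists g, g \oc y = f - u \oc w.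
  by apply: (conflation_desc hd); rewrite compBl -compA hw e subrr.
rewrite -(subrK (u \oc w) f) -hg; apply: via_projD; last exact: via_proj_comp.
by apply: via_proj_compr; exact: h2.
Qed.

Definition extension_closed U : Prop :=
  forall A B X (x : hom A B) (y : hom B X), conflation x y -> U A -> U X -> U B.

Lemma stable_iso_closed U : Proj C `<=` U -> extension_closed U ->
  (forall A P (S : biproduct A P), projective P -> U S -> U A) ->
  forall A B, stable_iso A B -> U A -> U B.
Proof.
move=> hP hE hS A B hAB hA.
have [Q [S [u [v [huv hQ]]]]] :=
  stable_iso_conflation hPI (conflation_hull A) (hull_projective A) hAB.
by apply: (hS _ _ S (hull_projective A)); apply: hE huv hA _; exact: hP.
Qed.

Lemma triangle_closed U : extension_closed U ->
  (forall A B, stable_iso A B -> U A -> U B) ->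
  forall A B X, triangle A B X -> U A -> U X -> U B.
Proof.
move=> hE hI A B X [A' [B' [X' [x [y [h [hA hB hX]]]]]]].
move=> /(hI _ _ (stable_iso_sym hA)) h1 /(hI _ _ (stable_iso_sym hX)) h2.
by apply: hI hB _; exact: hE h h1 h2.
Qed.

(** The hypothesis says [E^2(KX, HA) = 0]. It lets the class [push a d] extend along [c] to a class
    over [HX], realized by [HB]. The pullback [E] of [HB] along [c] is then the pushout of [B] along
    [a], and [ET4] for [B -> E -> HB] produces the cokernels. *)
Lemma horseshoe A B X HA KA HX KX (x : hom A B) (y : hom B X)
    (a : hom A HA) (a' : hom HA KA) (c : hom X HX) (c' : hom HX KX) :
  conflation x y -> conflation a a' -> conflation c c' ->
  stable_zero_hom KX (Sg (Sg HA)) ->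
  exists HB KB (b : hom B HB) (b' : hom HB KB) (h : hom HA HB) (h' : hom HB HX)
         (k : hom KA KB) (k' : hom KB KX),
    [/\ conflation b b', conflation h h' & conflation k k'].
Proof.
move=> [d hd] [dA hA] [dX hX] /ext1_eq0_Sigma hK.
have [Z [u [v [u' [v' [h1 h2]]]]]] := pushout_conflation hd hA.
have [t ht] := cosyzygy_lift J (push a d).
have [t' tE] := push0_extend hX (hK (push t dX)).
have [HB [h [h' hh]]] := realizes_exists (pull t' (delta J HA)).
have [E [m [p [q [d3 [[_ _ hm] [hE _ _]]]]]]] := ET4op hX hh.
move: hE; rewrite -pull_comp tE -ht => hE.
have [i [i' [i1 i2 _ _]]] := realizes_mid_unique h2 hE.
have [r [r' [dr hr]]] : exists (r : hom B E) (r' : hom E KA), conflation r r'.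
  by apply: conflation_mid_iso (ex_intro _ _ h1); exists i, i'.
have [KB [b' [k [k' [d4 [[_ _ hb] [hk _ _]]]]]]] := ET4 hr hm.
exists HB, KB, (m \oc r), b', h, h', k, k'; split; eexists; [exact: hb|exact: hh|exact: hk].
Qed.

Lemma conflation_cone W Z X B K (w : hom W Z) (z : hom Z X) (b : hom Z B) (k : hom B K) :
  conflation w z -> conflation b k ->
  exists E (e : hom B E) (m : hom X E) (n : hom E K),
    conflation (b \oc w) e /\ conflation m n.
Proof.
move=> [d hd] [d' hd']; have [E [e [m [n [d3 [[_ _ h1] [h2 _ _]]]]]]] := ET4 hd hd'.
by exists E, e, m, n; split; eexists; [exact: h1|exact: h2].
Qed.

Lemma stable_zero_hom_iter n X Y :
  stable_zero_hom X Y <-> stable_zero_hom (iter n Sg X) (iter n Sg Y).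
Proof. by elim: n => //= n IH; rewrite IH stable_zero_hom_Sigma. Qed.

(** Writing [X] stably as [Sigma^n Z] and cancelling the shifts reduces to morphisms into [P]
    itself. *)
Lemma stable_zero_hom_iter_proj n X P : projective P -> stable_zero_hom X (iter n Sg P).
Proof.
move=> hP; have [Z hZ] := iter_Sigma_surj n X; apply: stable_zero_homl hZ _.
by apply: (stable_zero_hom_iter n Z P).1; exact: stable_zero_hom_projr.
Qed.

Lemma stable_zero_hom_iter_summand n A B (S : biproduct A B) X :
  stable_zero_hom X (iter n Sg S) -> stable_zero_hom X (iter n Sg A).
Proof.
have [T] := biproduct_exists (iter n Sg A) (iter n Sg B).
move=> /(stable_zero_homr (stable_iso_iter_sum S T)) h f.
by rewrite -(comp1c f) -(prl_inl T) -compA; apply: via_proj_compl; exact: h.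
Qed.

Lemma stable_zero_hom_summandl A B (S : biproduct A B) X :
  stable_zero_hom S X -> stable_zero_hom A X.
Proof.
move=> h f; rewrite -(compc1 f) -(prl_inl S) compA; apply: via_proj_compr; exact: h.
Qed.

(** After two rotations [Sigma A] is the middle vertex between [X] and [Sigma B]. *)
Lemma stable_zero_hom_cocone A B X Y : triangle A B X ->
  stable_zero_hom B Y -> stable_zero_hom X (Sg Y) -> stable_zero_hom A Y.
Proof.
move=> /triangle_rot/triangle_rot h /stable_zero_hom_Sigma h1 h2.
by apply: (stable_zero_hom_Sigma _ _).2; exact: stable_zero_hom_comid h h2 h1.
Qed.

Lemma stable_zero_hom_cone i A B X Y : triangle A B X ->
  stable_zero_hom Y (iter i Sg B) -> stable_zero_hom Y (iter i.+1 Sg A) ->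
  stable_zero_hom Y (iter i Sg X).
Proof.
by rewrite iterSr => /triangle_rot/(triangle_iter i) h h1 h2; exact: stable_zero_hom_mid h h1 h2.
Qed.

Lemma stable_zero_hom_cocone_iter i A B X Y : triangle A B X ->
  stable_zero_hom Y (iter i Sg X) -> stable_zero_hom Y (iter i.+1 Sg B) ->
  stable_zero_hom Y (iter i.+1 Sg A).
Proof.
rewrite !iterSr => /triangle_rot/triangle_rot/(triangle_iter i) h h1 h2.
exact: stable_zero_hom_mid h h1 h2.
Qed.

Lemma right_perpE U Y : right_perp J U Y <->
  forall i, (0 < i)%N -> forall A, U A -> stable_zero_hom A (iter i Sg Y).
Proof. by split=> h i hi A hA; apply/(ext_eq0E _ _ hi); exact: h. Qed.

Lemma left_perpE U X : left_perp J U X <->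
  forall i, (0 < i)%N -> forall A, U A -> stable_zero_hom X (iter i Sg A).
Proof. by split=> h i hi A hA; apply/(ext_eq0E _ _ hi); exact: h. Qed.

(** * Closure properties of perpendicular classes *)

Section Perp.
Variable U : set C.

Lemma right_perp_triangle A B X :
  triangle A B X -> right_perp J U A -> right_perp J U X -> right_perp J U B.
Proof.
move=> h /right_perpE hA /right_perpE hX; apply/right_perpE => i hi Y hY.
by apply: stable_zero_hom_mid ((triangle_iter i _ _ _).1 h) _ _; [exact: hA|exact: hX].
Qed.

Lemma right_perp_extension : extension_closed (right_perp J U).
Proof. by move=> A B X x y /triangle_conflation; exact: right_perp_triangle. Qed.

Lemma right_perp_cone A B X :
  triangle A B X -> right_perp J U A -> right_perp J U B -> right_perp J U X.
Proof.
move=> h /right_perpE hA /right_perpE hB; apply/right_perpE => i hi Y hY.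
by apply: stable_zero_hom_cone h _ _; [exact: hB|exact: hA].
Qed.

Lemma right_perp_Sigma i A : right_perp J U A -> right_perp J U (iter i Sg A).
Proof.
move=> /right_perpE hA; apply/right_perpE => k hk Y hY.
by rewrite -iterD; apply: hA hY; rewrite addn_gt0 hk.
Qed.

Lemma right_perp_proj : Proj C `<=` right_perp J U.
Proof. by move=> P hP; apply/right_perpE => i _ A _; exact: stable_zero_hom_iter_proj. Qed.

Lemma right_perp_summand A B (S : biproduct A B) : right_perp J U S -> right_perp J U A.
Proof.
move=> /right_perpE h; apply/right_perpE => i hi Y hY.
by apply: stable_zero_hom_iter_summand (h i hi Y hY).
Qed.

Lemma right_perp_iso A B : stable_iso A B -> right_perp J U A -> right_perp J U B.
Proof.
move=> hAB /right_perpE h; apply/right_perpE => i hi Y hY.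
by apply: stable_zero_homr (h i hi Y hY); exact: (stable_iso_iter _ _ _).1.
Qed.

Lemma left_perp_triangle A B X :
  triangle A B X -> left_perp J U A -> left_perp J U X -> left_perp J U B.
Proof.
move=> h /left_perpE hA /left_perpE hX; apply/left_perpE => i hi Y hY.
by apply: stable_zero_hom_comid h _ _; [exact: hA|exact: hX].
Qed.

Lemma left_perp_extension : extension_closed (left_perp J U).
Proof. by move=> A B X x y /triangle_conflation; exact: left_perp_triangle. Qed.

Lemma left_perp_proj : Proj C `<=` left_perp J U.
Proof. by move=> P hP; apply/left_perpE => i _ A _; exact: stable_zero_hom_projl. Qed.

Lemma left_perp_summand A B (S : biproduct A B) : left_perp J U S -> left_perp J U A.
Proof.
move=> /left_perpE h; apply/left_perpE => i hi Y hY.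
exact: stable_zero_hom_summandl (h i hi Y hY).
Qed.

End Perp.

(** * Criteria for subcategories and for thick subcategories *)

Lemma subcategory_intro U : Proj C `<=` U -> extension_closed U ->
  (forall A B (S : biproduct A B), U S -> U A) -> is_subcategory U.
Proof.
move=> hP hE hS; split.
- by move=> Z /projective_zero; exact: hP.
- move=> A B hAB hA; have [Z hZ] := zero_exists C.
  have [x h] := conflation_iso hZ hAB.
  by apply: hE h hA _; exact/hP/projective_zero.
- by move=> A B S; apply: hE; exact: conflation_biproduct.
- by move=> A B S h; split; [exact: hS h | exact: (hS _ _ (biproduct_swap S))].
Qed.

Lemma projective_stable_zero P : projective P -> @is_zero (stable C) P.
Proof.
move=> hP A; split=> f; rewrite -[f](@cls_repr C); apply/via_proj_cls.
  exact: stable_zero_hom_projr.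
exact: stable_zero_hom_projl.
Qed.

Lemma is_zero_isomorphic (D : preadditive_category) (Z Z' : D) :
  is_zero Z -> is_zero Z' -> isomorphic Z Z'.
Proof.
move=> h h'; exists 0, 0; split.
  by rewrite comp0c; apply/esym; exact: (h Z).1.
by rewrite comp0c; apply/esym; exact: (h' Z').1.
Qed.

Lemma stable_subcategory_intro U : Proj C `<=` U -> extension_closed U ->
  (forall A B (S : biproduct A B), U S -> U A) -> @is_subcategory (stable C) U.
Proof.
move=> hP hE hS.
have hI := stable_iso_closed hP hE (fun A P S _ => hS A P S).
split.
- move=> Z hZ; have [Z0 hZ0] := zero_exists C; have hp := projective_zero hZ0.
  apply: (hI Z0); last exact: hP.
  exact: is_zero_isomorphic (projective_stable_zero hp) hZ.
- exact: hI.
- move=> A B S hA hB; have [T] := @biproduct_exists C A B.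
  apply: (hI T); first exact: stable_iso_sym (stable_biproductE S T).
  exact: hE (conflation_biproduct T) hA hB.
- move=> A B S h; have [T] := @biproduct_exists C A B.
  have hT : U T by apply: hI h; exact: stable_biproductE.
  by split; [exact: hS hT | exact: (hS _ _ (biproduct_swap T))].
Qed.

Lemma distinguished_triangle (A B X : stable C) (u : hom A B) (v : hom B X)
    (w : @hom (stable C) X (Sg A)) :
  stable_distinguished u v w -> triangle A B X.
Proof.
move=> [A' [B' [X' [u' [v' [w' [a [b [c [[x [y [z [d [h _ _]]]]] [ha hb hc] _ _ _]]]]]]]]]].
exists A', B', X', x, y; split; first by exists d.
by split; [exists a | exists b | exists c].
Qed.

Lemma conflation_distinguished A B X (x : hom A B) (y : hom B X) : conflation x y ->
  exists w, @stable_distinguished C J A B X (cls x) (cls y) w.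
Proof.
move=> [d hd]; have [z hz] := cosyzygy_lift J d.
exists (cls z), A, B, X, (cls x), (cls y), (cls z), (idc _), (idc _), (idc _).
have iso1 (Y : stable C) : is_iso (idc Y) by exists (idc Y); rewrite comp1c.
split; rewrite ?comp1c ?compc1 //.
  by exists x, y, z, d.
rewrite (@stable_shift_homE _ _ _ _ (idc A) (idc (Sg A)) hPI) ?push1 ?pull1 //.
by rewrite -[RHS](@comp1c (stable C)).
Qed.

(** Closure under extensions and both shifts suffices for triangles: by rotation each vertex is, up
    to shift, the middle one. *)
Lemma thick_intro U : Proj C `<=` U -> extension_closed U ->
  (forall A B (S : biproduct A B), U S -> U A) ->
  (forall A, U A <-> U (Sg A)) -> thick (stable_triangles J) U.
Proof.
move=> hP hE hS hsh.
have hI := stable_iso_closed hP hE (fun A P S _ => hS A P S).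
have hT := triangle_closed hE hI.
split; first exact: stable_subcategory_intro.
  exact: hsh.
move=> A B X u v w /distinguished_triangle h; split.
- move=> /hsh hA hB; exact: hT ((triangle_rot _ _ _).1 h) hB hA.
- move=> /hsh hB' hX; apply/hsh.
  have h' := (triangle_rot _ _ _).1 ((triangle_rot _ _ _).1 h).
  by exact: hT h' hX hB'.
- by move=> hA hX; exact: hT h hA hX.
Qed.

Lemma thick_conflation U A B X (x : hom A B) (y : hom B X) :
  thick (stable_triangles J) U -> conflation x y ->
  [/\ U A -> U B -> U X, U B -> U X -> U A & U A -> U X -> U B].
Proof.
by move=> [_ _ hU] /conflation_distinguished[w]; exact: hU.
Qed.

(** Coresolutions of length [n] in recursive form, so that the first conflation can be peeled off in
    inductions. *)
Fixpoint coresolved U n : set C :=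
  if n is m.+1 then [set X | exists B K (x : hom X B) (y : hom B K),
    [/\ conflation x y, U B & coresolved U m K]]
  else U.

Lemma check_class_coresolved U X :
  (forall A B, isomorphic A B -> U A -> U B) ->
  check_class U X -> exists n, coresolved U n X.
Proof.
move=> hI [n [B [K [<- hKn hB hK]]]]; exists n.
elim: n B K hKn hB hK => [|n IH] B K hKn hB hK /=.
  by apply: hI (hB 0%N _) => //; exact: isomorphic_sym.
have [x [y h]] := hK 0%N isT.
exists (B 0%N), (K 1%N), x, y; split=> //; first exact: hB.
apply: (IH (fun i => B i.+1) (fun i => K i.+1)) => // i hi.
  exact: hB.
exact: hK.
Qed.

Lemma check_class_iter U n X :
  Proj C `<=` U -> U (iter n Sg X) -> check_class U X.
Proof.
move=> hP hU; exists n.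
exists (fun i => if (i < n)%N then hull J (iter i Sg X) else iter i Sg X).
exists (fun i => iter i Sg X); split=> //.
- by rewrite ltnn; exact: isomorphic_refl.
- move=> i; rewrite leq_eqVlt => /orP[/eqP->|hi]; first by rewrite ltnn.
  by rewrite hi; apply: hP; exact: hull_projective.
- by move=> i hi; rewrite hi; exists (hull_in J _), (hull_out J _); exact: conflation_hull.
Qed.

(** * From silting to coresolving subcategories *)

Section SiltingToCoresolving.
Variable M : set C.
Hypotheses (hPM : Proj C `<=` M) (hM : silting (stable_triangles J) M).

Local Notation H := (right_perp J M).

Lemma silting_stable_iso A B : stable_iso A B -> M A -> M B.
Proof. by have [hU _ _] := hM; exact: subcat_iso hU _ _. Qed.

Lemma silting_zero i A B : (0 < i)%N -> M A -> M B -> stable_zero_hom A (iter i Sg B).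
Proof.
by move=> hi hA hB f; apply/via_proj_cls; exact: silting_rigid hM _ _ hA hB _ hi (cls f).
Qed.

Lemma silting_right_perp : M `<=` H.
Proof. by move=> A hA; apply/right_perpE => i hi B hB; exact: silting_zero. Qed.

Lemma silting_extension : extension_closed M.
Proof.
move=> A B X x y [d hd] hA hX.
have d0 : d = 0.
  by apply: ((ext1_eq0_Sigma X A).2 _ d); exact: (@silting_zero 1).
move: hd; rewrite d0 => hd; have [S] := biproduct_exists A X.
apply: (silting_stable_iso (isomorphic_stable (split_conflation S hd))).
apply: (silting_stable_iso (stable_biproductE (stable_biproduct S) S)).
by have [hU _ _] := hM; exact: subcat_sum hU _ _ _ hA hX.
Qed.

Lemma coresolvedS n : coresolved M n `<=` coresolved M n.+1.
Proof.
elim: n => [|n IH] K.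
  move=> hK; have [Z hZ] := zero_exists C.
  exists K, Z, (idc K), 0; split=> //; first exact: conflation_idl.
  exact/hPM/projective_zero.
move=> [B [L [x [y [h hB hL]]]]]; exists B, L, x, y; split=> //; exact: IH.
Qed.

Lemma coresolved_le m n : (m <= n)%N -> coresolved M m `<=` coresolved M n.
Proof.
move=> /subnK <-; elim: (n - m)%N => // k IH K hK.
by apply: coresolvedS; exact: IH.
Qed.

(** Dimension shifting: [E^i(K, A)] lies between [E^i(B, A)] and [E^{i+1}(L, A)]. *)
Lemma coresolved_left_perp n K : coresolved M n K -> left_perp J H K.
Proof.
elim: n K => [|n IH] K.
  by move=> hK; apply/left_perpE => i hi A /right_perpE hA; exact: hA.
move=> [B [L [x [y [/triangle_conflation h hB /IH/left_perpE hL]]]]].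
apply/left_perpE => i hi A hA; apply: stable_zero_hom_cocone h _ _.
  by move/right_perpE: hA; apply.
exact: hL i.+1 _ _ hA.
Qed.

(** Induction with the horseshoe lemma; its [E^2] condition holds because [KX] is left orthogonal to
    [H], which contains [M]. *)
Lemma coresolved_extension n : extension_closed (coresolved M n).
Proof.
elim: n => [|n IH] A B X x y h; first exact: silting_extension h.
move=> [BA [KA [a [a' [ha hBA hKA]]]]] [BX [KX [c [c' [hc hBX hKX]]]]].
have hz : stable_zero_hom KX (Sg (Sg BA)).
  have /left_perpE := coresolved_left_perp hKX.
  by move/(_ 2%N isT BA); apply; exact: silting_right_perp.
have [B' [K [b [b' [i [i' [k [k' [h1 h2 h3]]]]]]]]] := horseshoe h ha hc hz.
exists B', K, b, b'; split=> //; first exact: silting_extension h2 hBA hBX.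
exact: IH h3 hKA hKX.
Qed.

Definition approximable X : Prop :=
  exists B K (x : hom X B) (y : hom B K) n, [/\ conflation x y, H B & coresolved M n K].

Lemma right_perp_approximable X : H X -> approximable X.
Proof.
move=> hX; have [Z hZ] := zero_exists C.
exists X, Z, (idc X), 0, 0%N; split=> //; first exact: conflation_idl.
exact/hPM/projective_zero.
Qed.

Lemma approximable_extension : extension_closed approximable.
Proof.
move=> A B X x y h.
move=> [BA [KA [a [a' [n [ha hBA hKA]]]]]] [BX [KX [c [c' [m [hc hBX hKX]]]]]].
have hz : stable_zero_hom KX (Sg (Sg BA)).
  by have /left_perpE/(_ 2%N isT BA) := coresolved_left_perp hKX; exact.
have [B' [K [b [b' [i [i' [k [k' [h1 h2 h3]]]]]]]]] := horseshoe h ha hc hz.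
exists B', K, b, b', (maxn n m); split=> //.
  exact: right_perp_extension h2 hBA hBX.
apply: coresolved_extension h3 _ _.
  exact: coresolved_le (leq_maxl n m) _ hKA.
exact: coresolved_le (leq_maxr n m) _ hKX.
Qed.

(** [X] embeds in the cone of [W -> Z -> B] with the same cokernel [K], and [H] is closed under
    cones. With [W] projective this removes a projective summand. *)
Lemma approximable_cone W Z X (w : hom W Z) (z : hom Z X) :
  conflation w z -> H W -> approximable Z -> approximable X.
Proof.
move=> h hW [B [K [b [k [n [hb hB hK]]]]]].
have [E [e [m [p [h1 h2]]]]] := conflation_cone h hb.
exists E, K, m, p, n; split=> //.
exact: right_perp_cone (triangle_conflation h1) hW hB.
Qed.

Lemma approximable_iso A B : stable_iso A B -> approximable A -> approximable B.
Proof.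
apply: stable_iso_closed.
- by move=> P hP; apply: right_perp_approximable; exact: right_perp_proj.
- exact: approximable_extension.
- move=> X P S hP; apply: approximable_cone (conflation_biproduct (biproduct_swap S)) _.
  exact: right_perp_proj.
Qed.

Lemma approximable_triangle A B X :
  triangle A B X -> approximable A -> approximable X -> approximable B.
Proof. exact: (triangle_closed approximable_extension approximable_iso). Qed.

Lemma desuspension_coresolved k Z A : M A -> stable_iso (iter k Sg Z) A -> coresolved M k Z.
Proof.
move=> hA; elim: k Z => [|k IH] Z hZ; first exact: silting_stable_iso (stable_iso_sym hZ) hA.
exists (hull J Z), (Sg Z), (hull_in J Z), (hull_out J Z); split.
- exact: conflation_hull.
- by apply: hPM; exact: hull_projective.
- by apply: IH; rewrite -iterSr.
Qed.

Lemma desuspension_approximable k Z A :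
  M A -> stable_iso (iter k Sg Z) A -> approximable Z.
Proof.
case: k => [|k] hA hZ.
  apply: approximable_iso (stable_iso_sym hZ) _.
  by apply: right_perp_approximable; exact: silting_right_perp.
exists (hull J Z), (Sg Z), (hull_in J Z), (hull_out J Z), k; split.
- exact: conflation_hull.
- by apply: right_perp_proj; exact: hull_projective.
- by apply: desuspension_coresolved hA _; rewrite -iterSr.
Qed.

(** The first half puts high shifts of [X] into [H]; the second gives the bound on [E^i(X, H)]
    required of coresolving classes. *)
Definition perp_bounded : set C := [set X | exists n, forall i, (n <= i)%N ->
  (forall A, M A -> stable_zero_hom A (iter i Sg X)) /\
  (forall A, H A -> stable_zero_hom X (iter i Sg A))].

Lemma perp_bounded_thick : thick (stable_triangles J) perp_bounded.
Proof.
apply: thick_intro.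
- move=> P hP; exists 0%N => i _; split=> A _; first exact: stable_zero_hom_iter_proj.
  exact: stable_zero_hom_projl.
- move=> A B X x y /triangle_conflation h [n hn] [m hm]; exists (maxn n m) => i.
  rewrite geq_max => /andP[/hn[h1 h2] /hm[h3 h4]]; split=> Y hY.
    by apply: stable_zero_hom_mid ((triangle_iter i _ _ _).1 h) _ _; [exact: h1|exact: h3].
  by apply: stable_zero_hom_comid h _ _; [exact: h2|exact: h4].
- move=> A B S [n hn]; exists n => i /hn[h1 h2]; split=> Y hY.
    exact: stable_zero_hom_iter_summand (h1 Y hY).
  exact: stable_zero_hom_summandl (h2 Y hY).
(* Shifting [A] raises the degree in one half and lowers it in the other; the bound [n + 1] absorbs
   both. *)
- move=> A; split=> [] [n hn]; exists n.+1 => -[//|i] hi; split=> Y hY.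
  + by rewrite -iterSr; apply: (hn i.+2 _).1 => //; exact: leqW (leqW hi).
  + by apply: (stable_zero_hom_Sigma _ _).1; exact: (hn i hi).2.
  + by rewrite iterSr; exact: (hn i hi).1.
  + by apply: (stable_zero_hom_Sigma _ _).2; apply: (hn i.+2 _).2 => //; exact: leqW (leqW hi).
Qed.

Lemma silting_perp_bounded X : perp_bounded X.
Proof.
apply: (silting_generates hM perp_bounded_thick) => // A hA.
exists 1%N => i hi; split=> Y hY; first exact: silting_zero.
by have /right_perpE := hY; apply.
Qed.

Lemma iter_Sigma_right_perp X : exists n, forall i, (n <= i)%N -> H (iter i Sg X).
Proof.
have [n hn] := silting_perp_bounded X; exists n => i hi; apply/right_perpE => k hk A hA.
by rewrite -iterD; apply: (hn _ _).1 => //; apply: leq_trans hi _; exact: leq_addl.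
Qed.

(** [Z] ranges over the objects stably isomorphic to [X[m - n]]; negative shifts are expressed this
    way because [Sigma] has no chosen inverse. *)
Definition shifts_approximable : set C :=
  [set X | forall n m Z, stable_iso (iter n Sg Z) (iter m Sg X) -> approximable Z].

Lemma descending_induction (P : nat -> Prop) N :
  (forall j, (N <= j)%N -> P j) -> (forall j, P j.+1 -> P j) -> P 0%N.
Proof.
move=> hN hS; elim: N hN => [|N IH] hN; first exact: hN.
apply: IH => j; rewrite leq_eqVlt => /orP[/eqP<-|]; last exact: hN.
exact/hS/hN.
Qed.

(* With V = Z (+) W there are triangles V -> Z -> W[1] and V -> W -> Z[1], so that
   the summands are treated simultaneously, by descending induction on the shift. *)
Lemma shifts_approximable_summand A B (S : biproduct A B) :
  shifts_approximable S -> shifts_approximable A.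
Proof.
move=> hS n m Z hZ; have [W hW] := iter_Sigma_surj n (iter m Sg B).
suff [] : approximable (iter 0 Sg Z) /\ approximable (iter 0 Sg W) by [].
have [N1 h1] := iter_Sigma_right_perp Z; have [N2 h2] := iter_Sigma_right_perp W.
apply: (@descending_induction
  (fun j => approximable (iter j Sg Z) /\ approximable (iter j Sg W)) (maxn N1 N2)) => j.
  rewrite geq_max => /andP[hj1 hj2].
  by split; apply: right_perp_approximable; [exact: h1|exact: h2].
move=> [hjZ hjW]; have [V] := biproduct_exists (iter j Sg Z) (iter j Sg W).
have hV : approximable V.
  (* [V] is stably the shift of [S] by [m + j - n]. *)
  apply: (hS n (m + j)%N).
  have [V0] := biproduct_exists Z W.
  have [V1] := biproduct_exists (iter n Sg Z) (iter n Sg W).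
  have [V2] := biproduct_exists (iter m Sg A) (iter m Sg B).
  have h3 : stable_iso (iter n Sg V0) (iter m Sg S).
    apply: stable_iso_trans (stable_iso_iter_sum V0 V1) _.
    apply: stable_iso_trans (stable_iso_biproduct V1 V2 hZ hW) _.
    exact: stable_iso_sym (stable_iso_iter_sum S V2).
  apply: (@stable_iso_trans _ (iter n Sg (iter j Sg V0))).
    by apply: (stable_iso_iter n _ _).1; apply: stable_iso_sym; exact: stable_iso_iter_sum.
  rewrite -!iterD addnC iterD (addnC m) iterD.
  exact: (stable_iso_iter j _ _).1.
split.
  have /triangle_conflation/triangle_rot h := conflation_biproduct (biproduct_swap V).
  exact: approximable_triangle h hV hjW.
have /triangle_conflation/triangle_rot h := conflation_biproduct V.
exact: approximable_triangle h hV hjZ.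
Qed.

(** Nonnegative shifts of [M] lie in [H]; negative ones are coresolved by hulls ending in [M]. *)
Lemma silting_shifts_approximable : M `<=` shifts_approximable.
Proof.
move=> X hX n m Z; case: (leqP n m) => [/subnKC <-|/ltnW/subnKC <-].
  rewrite iterD => h; apply: (approximable_iso (stable_iso_sym ((stable_iso_iter n _ _).2 h))).
  by apply: right_perp_approximable; apply: right_perp_Sigma; exact: silting_right_perp.
rewrite iterD => h; exact: desuspension_approximable hX ((stable_iso_iter m _ _).2 h).
Qed.

Lemma shifts_approximable_thick : thick (stable_triangles J) shifts_approximable.
Proof.
apply: thick_intro.
- by move=> P /hPM; exact: silting_shifts_approximable.
- move=> A B X x y /triangle_conflation h hA hX n m Z hZ.
  have [ZA hZA] := iter_Sigma_surj n (iter m Sg A).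
  have [ZX hZX] := iter_Sigma_surj n (iter m Sg X).
  have {}h := (triangle_iter m _ _ _).1 h.
  have {}h := triangle_iso (stable_iso_sym hZA) (stable_iso_sym hZ) (stable_iso_sym hZX) h.
  have {}h := (triangle_iter n _ _ _).2 h.
  exact: approximable_triangle h (hA _ _ _ hZA) (hX _ _ _ hZX).
- exact: shifts_approximable_summand.
- move=> A; split=> hA n m Z; first by rewrite -iterSr; exact: hA.
  by move=> h; apply: (hA n.+1 m); rewrite -iterSr; exact: (stable_iso_Sigma _ _).1.
Qed.

Lemma silting_approximable X : approximable X.
Proof.
have h : shifts_approximable X.
  exact: (silting_generates hM shifts_approximable_thick silting_shifts_approximable).
exact: (h 0%N 0%N X (stable_iso_refl X)).
Qed.

Lemma right_perp_coresolving_class : coresolving_class J H.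
Proof.
split.
- exact: subcategory_intro (@right_perp_proj M) (@right_perp_extension M) (@right_perp_summand M).
- move=> X; have [B [K [x [y [n [h hB hK]]]]]] := silting_approximable X.
  exists B, K, x, y; split=> // Y hY.
  by apply/ext1_eq0_Sigma; have /left_perpE/(_ 1%N isT Y hY) := coresolved_left_perp hK.
- split; first by rewrite -hPI; exact: right_perp_proj.
    exact: right_perp_extension.
  by move=> A B X x y /triangle_conflation; exact: right_perp_cone.
- apply/seteqP; split=> // X _; have [n hn] := iter_Sigma_right_perp X.
  by apply: (@check_class_iter _ n); [exact: right_perp_proj|exact: hn].
(* The successor makes the bound positive. *)
- move=> X _; have [n hn] := silting_perp_bounded X; exists n.+1 => // i hi Y hY.
  by apply/ext_eq0E; [case: i hi|exact: (hn i (ltnW hi)).2].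
Qed.

(** For the inclusion in [M], approximate a syzygy [W] of [X] and push out: [P -> Z -> K] makes [Z]
    stably [K], and [B -> Z -> X] splits because [E(X, B) = 0]. So [X] is a summand of [Z], and it
    remains to see that [K] is in [M]. *)
Lemma silting_heart : H `&` left_perp J H = M.
Proof.
apply/seteqP; split=> X; last first.
  move=> hX; split; first exact: silting_right_perp.
  exact: (@coresolved_left_perp 0).
move=> [hX hX'].
have [hP _ _] := hC; have [W [P [i [p [hp [d hd]]]]]] := hP X.
have [B [K [b [k [n [[e he] hB hK]]]]]] := silting_approximable W.
have [Z [u [v [u' [v' [h1 h2]]]]]] := pushout_conflation hd he.
have h1c : conflation u v by exists (push i e).
have h2c : conflation u' v' by exists (push b d).
have hZK : stable_iso Z K := split_stable_isol hp h1c.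
have hK' : H K by apply: right_perp_iso hZK _; exact: right_perp_extension h2c hB hX.
have hMK : M K.
  (* If the coresolution of [K] has positive length, its first conflation splits since [K] is in [H]
     and [L] is left orthogonal to [H]. *)
  case: n hK => // n [B' [L [x [y [[dK hdK] hB' hL]]]]].
  have d0 : dK = 0.
    apply: (ext1_eq0_Sigma L K).2.
    by have /left_perpE/(_ 1%N isT K hK') := coresolved_left_perp hL.
  move: hdK; rewrite d0 => hdK; have [S] := biproduct_exists K L.
  have hS : M S.
    apply: silting_stable_iso hB'.
    exact/isomorphic_stable/isomorphic_sym/(split_conflation S hdK).
  have [hU _ _] := hM.
  by have [] := subcat_summand hU (S := stable_biproduct S) hS.
have hMZ : M Z := silting_stable_iso (stable_iso_sym hZK) hMK.
have hd0 : push b d = 0.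
  apply: (ext1_eq0_Sigma X B).2.
  by move/left_perpE/(_ 1%N isT B hB): hX'.
move: h2; rewrite hd0 => h2; have [S] := biproduct_exists B X.
have hS : M S.
  by apply: silting_stable_iso hMZ; apply/isomorphic_stable/isomorphic_sym/(split_conflation S h2).
have [hU _ _] := hM.
by have [] := subcat_summand hU (S := stable_biproduct S) hS.
Qed.

End SiltingToCoresolving.

(** * From coresolving to silting subcategories *)

Section CoresolvingToSilting.
Variable H : set C.
Hypothesis hH : coresolving_class J H.

Local Notation M := (H `&` left_perp J H).

Let H_proj : Proj C `<=` H.
Proof. by have [_ _ [h _ _] _ _] := hH; rewrite hPI. Qed.

Let H_extension : extension_closed H.
Proof. by have [_ _ [_ h _] _ _] := hH. Qed.

Let H_cone A B X (x : hom A B) (y : hom B X) : conflation x y -> H A -> H B -> H X.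
Proof. by have [_ _ [_ _ h] _ _] := hH; exact: h. Qed.

Let H_summand A B (S : biproduct A B) : H S -> H A.
Proof. by have [h _ _ _ _] := hH; case/(subcat_summand h). Qed.

Let H_Sigma i A : H A -> H (iter i Sg A).
Proof.
move=> hA; elim: i => //= i IH; apply: H_cone (conflation_hull _) IH _.
by apply: H_proj; exact: hull_projective.
Qed.

Lemma coresolving_right_perp : H `<=` right_perp J M.
Proof. by move=> Y hY; apply/right_perpE => i hi A [_ /left_perpE hA]; exact: hA. Qed.

(** Since [H] is closed under cosyzygies, vanishing of [E(K, H)] gives vanishing in all higher
    degrees. *)
Lemma coresolving_approximation X :
  exists B K (x : hom X B) (y : hom B K), [/\ conflation x y, H B & left_perp J H K].
Proof.
have [_ h _ _ _] := hH; have [B [K [x [y [hxy hB hK]]]]] := h X.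
exists B, K, x, y; split=> // i hi A hA d.
by apply: hK; exact: H_Sigma.
Qed.

Lemma coresolving_heart_proj : Proj C `<=` M.
Proof. by move=> P hP; split; [exact: H_proj | exact: left_perp_proj]. Qed.

Lemma coresolving_heart_extension : extension_closed M.
Proof.
move=> A B X x y h [hA hA'] [hX hX']; split; first exact: H_extension h hA hX.
exact: left_perp_extension h hA' hX'.
Qed.

Lemma coresolving_heart_summand A B (S : biproduct A B) : M S -> M A.
Proof. by move=> [h h']; split; [exact: H_summand h | exact: left_perp_summand h']. Qed.

(** [Z] is the pushout of [P] and [B] over a syzygy [W] of [X]: it lies in [H] as an extension of
    [X] by [B], and in the left perp as an extension of [K] by [P]. *)
Lemma coresolving_heart_cover X : H X ->
  exists B Z (u : hom B Z) (v : hom Z X), [/\ conflation u v, H B & M Z].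
Proof.
move=> hX; have [hP _ _] := hC; have [W [P [i [p [hp [d hd]]]]]] := hP X.
have [B [K [b [k [[e he] hB hK]]]]] := coresolving_approximation W.
have [Z [u [v [u' [v' [h1 h2]]]]]] := pushout_conflation hd he.
have h1c : conflation u v by exists (push i e).
have h2c : conflation u' v' by exists (push b d).
exists B, Z, u', v'; split=> //; split; first exact: H_extension h2c hB hX.
exact: left_perp_extension h1c (left_perp_proj hp) hK.
Qed.

Lemma coresolving_generates U : thick (stable_triangles J) U -> M `<=` U -> setT `<=` U.
Proof.
move=> hU hMU.
(* Induction on the top degree [n] of nonvanishing. At [n = 0] the object lies in the heart;
   otherwise the kernel [B] of a cover has a bound smaller by one. *)
have hHU n X : H X -> (forall i, (n < i)%N -> forall A, H A -> stable_zero_hom X (iter i Sg A)) ->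
    U X.
  elim: n X => [|n IH] X hX hn.
    by apply: hMU; split=> //; apply/left_perpE.
  have [B [Z [u [v [h hB hZ]]]]] := coresolving_heart_cover hX.
  have [hcone _ _] := thick_conflation hU h.
  apply: hcone (hMU _ hZ); apply: IH hB _ => i hi A hA.
  apply: stable_zero_hom_cocone (triangle_conflation h) _ (hn i.+1 _ _ hA) => //.
  have [_ /left_perpE hZ'] := hZ; apply: hZ' hA; exact: leq_trans hi.
have {}hHU : H `<=` U.
  move=> X hX; have [_ _ _ _ hb] := hH; have [t ht hX'] := hb X hX.
  apply: (hHU t _ hX) => i hi A hA; apply/ext_eq0E; first exact: leq_trans hi.
  by apply: hX' hA; exact: ltnW.
(* The remaining objects are reached from [H] by taking cocones along a finite coresolution. *)
move=> X _; have [hsub _ _ hcheck _] := hH.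
have : check_class H X by rewrite hcheck.
case/(check_class_coresolved (subcat_iso hsub)) => n; elim: n X => [|n IH] X; first exact: hHU.
move=> [B [K [x [y [h hB hK]]]]]; have [_ hcocone _] := thick_conflation hU h.
by apply: hcocone; [exact: hHU | exact: IH].
Qed.

Lemma coresolving_heart_silting : silting (stable_triangles J) M.
Proof.
split.
- exact: stable_subcategory_intro coresolving_heart_proj coresolving_heart_extension
    coresolving_heart_summand.
- move=> A B [_ /left_perpE hA] [hB _] i hi f; rewrite -[f](@cls_repr C).
  by apply/via_proj_cls; exact: hA.
- exact: coresolving_generates.
Qed.

(** Each step of the coresolution of [Y] costs one degree. *)
Lemma coresolved_left_perp_zero n Y K i : coresolved H n Y -> left_perp J H K ->
  (n < i)%N -> stable_zero_hom K (iter i Sg Y).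
Proof.
elim: n Y i => [|n IH] Y i; first by move=> hY /left_perpE hK hi; exact: hK.
move=> [B [Y' [x [y [/triangle_conflation h hB hY']]]]] hK; case: i => // i hi.
apply: stable_zero_hom_cocone_iter h _ _; first exact: IH.
by move/left_perpE: hK; exact.
Qed.

Lemma right_perp_heart : right_perp J M = H.
Proof.
apply/seteqP; split=> Y; last exact: coresolving_right_perp.
move=> /right_perpE hY.
have [hsub _ _ hcheck _] := hH.
have [n hn] : exists n, coresolved H n Y.
  by apply: (check_class_coresolved (subcat_iso hsub)); rewrite hcheck.
(* The parameter [k] bounds the remaining distance to the degrees above [n]. In [K -> B -> L] the
   term [B] is in the heart, so [E^i(K, Y)] vanishes once [E^{i+1}(L, Y)] does. *)
have key k K i : left_perp J H K -> (0 < i)%N -> (n < i + k)%N -> stable_zero_hom K (iter i Sg Y).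
  elim: k K i => [|k IH] K i hK hi hik.
    by apply: coresolved_left_perp_zero hn hK _; rewrite addn0 in hik.
  have [B [L [x [y [h hB hL]]]]] := coresolving_approximation K.
  have hB' : M B by split=> //; exact: left_perp_extension h hK hL.
  apply: stable_zero_hom_cocone (triangle_conflation h) (hY i hi B hB') _.
  by apply: (IH L i.+1) => //; rewrite addSnnS.
have [B [K [x [y [[d hd] hB hK]]]]] := coresolving_approximation Y.
have d0 : d = 0.
  (* Degree 1 is below the range [i > n] by at most [n] steps, hence [k = n]. *)
  by apply: ((ext1_eq0_Sigma K Y).2 _ d); apply: (key n K 1%N) => //; rewrite add1n.
move: hd; rewrite d0 => hd; have [S] := biproduct_exists Y K.
apply: (H_summand (S := S)); apply: (subcat_iso hsub) hB.
exact: isomorphic_sym (split_conflation S hd).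
Qed.

Lemma heart_silting_class : silting_class J (Phi J H).
Proof.
exists M; split.
- exact: subcategory_intro coresolving_heart_proj coresolving_heart_extension
    coresolving_heart_summand.
- exact: coresolving_heart_proj.
- by [].
- exact: coresolving_heart_silting.
Qed.

End CoresolvingToSilting.

End StableTriangulation.

Theorem theorem1p1 (C : extriangulated_category) (J : cosyzygy_choice C)
    (hC : frobenius C) :
  [/\ forall S : set (stable C), silting_class J S -> coresolving_class J (Psi J S),
      forall H : set C, coresolving_class J H -> silting_class J (Phi J H),
      forall S : set (stable C), silting_class J S -> Phi J (Psi J S) = S
    & forall H : set C, coresolving_class J H -> Psi J (Phi J H) = H].
Proof.
split.
- by move=> S [M [_ hPM -> hM]]; exact (right_perp_coresolving_class hC hPM hM).
- by move=> H; exact: heart_silting_class.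
- by move=> S [M [_ hPM -> hM]]; exact (silting_heart hC hPM hM).
- by move=> H; exact: right_perp_heart.
Qed.
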